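(* Let $K$ be a number field with ring of integers $\mathcal O_K$, unit group $\mathcal O_K^{\times}$ of rank $r$, and group of roots of unity $\mu_K$. Fix integral ideals $\mathfrak a_1,\ldots,\mathfrak a_h$ forming a complete set of representatives of the ideal class group of $\mathcal O_K$, and fix a system of fundamental units $\epsilon_1,\ldots,\epsilon_r$. Let $B\ge 1$. For each $\ell\in\{1,\ldots,h\}$, let $g_{\ell,1},\ldots,g_{\ell,s_\ell}\in\mathcal O_K$ be generators of all the distinct nonzero principal ideals contained in $\mathfrak a_\ell$ whose norms are at most $B\cdot N(\mathfrak a_\ell)$, one generator for each such ideal. A $B$-packet is a tuple $P=(\ell,(i,j),(n_1,\ldots,n_r))$ with $n_1,\ldots,n_r\in\mathbb Z$ such that: $1\le \ell\le h$; $1\le i<j\le s_\ell$; the ideal $(g_{\ell,i},g_{\ell,j})$ generated by $g_{\ell,i}$ and $g_{\ell,j}$ equals $\mathfrak a_\ell$; and $H_K(\epsilon_1^{n_1}\cdots\epsilon_r^{n_r})\le B\cdot H_K(g_{\ell,i}/g_{\ell,j})$. (If $r=0$, a packet is a tuple $(\ell,(i,j))$ satisfying only the first three conditions.) To a packet $P$ associate $c(P)=\epsilon_1^{n_1}\cdots\epsilon_r^{n_r}\cdot g_{\ell,i}/g_{\ell,j}\in K^{*}$ and the set $F(P)=\{\zeta c(P):\zeta\in\mu_K\}\cup\{\zeta/c(P):\zeta\in\mu_K\}$. Then every $\gamma\in K^{*}$ with $H_K(\gamma)\le B$ either lies in $\mathcal O_K^{\times}$ or lies in $\bigcup_{P}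 F(P)$, the union over all $B$-packets $P$; moreover the sets $F(P)$ for distinct $B$-packets $P$ are pairwise disjoint.
   Context: For a number field $K$, $M_K$ denotes its set of places: the archimedean ones (one for each real embedding $\sigma$, with $|x|_\sigma=|\sigma(x)|$, local degree $n_v=1$; one for each pair of complex conjugate embeddings $\tau$, with $|x|_\tau=|\tau(x)|$, $n_v=2$) and the nonarchimedean ones, one for each maximal ideal $\mathfrak p$ of $\mathcal O_K$, with $|x|_{\mathfrak p}=N(\mathfrak p)^{-v_{\mathfrak p}(x)/(e(\mathfrak p)f(\mathfrak p))}$ and $n_v=e(\mathfrak p)f(\mathfrak p)$. The relative height is $H_K(\gamma)=\prod_{v\in M_K}\max\{|\gamma|_v^{n_v},1\}$ for $\gamma\in K$. $N(I)=\#(\mathcal O_K/I)$ is the norm of an ideal $I$. Fundamental units $\epsilon_1,\ldots,\epsilon_r$ are units such that every unit is uniquely $\zeta\epsilon_1^{m_1}\cdots\epsilon_r^{m_r}$ with $\zeta\in\mu_K$, $m_i\in\mathbb Z$. *)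

(* Defs.v *)
From HB Require Import structures.
From mathcomp Require Import all_boot all_order all_algebra all_field.
From mathcomp Require Import complex finmap.
From mathcomp Require Import all_classical all_reals exp.

Set Implicit Arguments.
Unset Strict Implicit.
Unset Printing Implicit Defensive.

Import Order.TTheory GRing.Theory Num.Theory.
Local Open Scope classical_set_scope.
Local Open Scope ring_scope.

Section Integers.
Variable K : fieldExtType rat.
Implicit Types (I J P : set K) (x y : K).

Definition integers : set K := [set x | integralOver (intr : int -> K) x].

Definition unit_group : set K :=
  [set x | integers x /\ exists2 y, integers y & x * y = 1].

Definition roots_of_unity : set K :=
  [set z | exists2 n : nat, (0 < n)%N & z ^+ n = 1].

Definition is_submodule I :=
  [/\ I 0, forall x y, I x -> I y -> I (x - y)
    & forall c x, integers c -> I x -> I (c * x)].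

Definition is_nonzero I := exists2 x, I x & x != 0.

Definition is_ideal I := is_submodule I /\ I `<=` integers.

Definition is_fractional_ideal I :=
  [/\ is_submodule I, is_nonzero I
    & exists d, [/\ integers d, d != 0 & forall x, I x -> integers (d * x)]].

Definition principal x : set K := [set c * x | c in integers].

Definition gen2 x y : set K :=
  [set c * x + d * y | c in integers & d in integers].

Definition cosets I : set (set K) :=
  [set [set x + y | y in I] | x in integers].

(* #(O_K / I); the value is 0 when O_K / I is infinite, which for an ideal I
   happens only if I = {0}. *)
Definition idealN I : nat := #|` fset_set (cosets I)|%fset.

Definition ideal_mul I J : set K :=
  [set x | exists n (u v : 'I_n -> K),
    (forall i, I (u i) /\ J (v i)) /\ x = \sum_i u i * v i].

Fixpoint ideal_exp I (n : nat) : set K :=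
  if n is m.+1 then ideal_mul I (ideal_exp I m) else integers.

Definition is_maximal_ideal P :=
  [/\ is_ideal P, P <> integers
    & forall J, is_ideal J -> P `<=` J -> J = P \/ J = integers].

(* Fractional ideals I and J have the same class in the ideal class group,
   i.e. in fractional ideals modulo principal fractional ideals. *)
Definition same_class I J := exists2 c, c != 0 & J = [set c * x | x in I].

Definition class_representatives (h : nat) (a : 'I_h -> set K) :=
  (forall l, is_ideal (a l) /\ is_nonzero (a l)) /\
  (forall I, is_fractional_ideal I -> exists! l, same_class (a l) I).

(* v_P(x) = n, for x != 0: write x = a / b with a, b nonzero in O_K, where
   P^k and P^l are the exact powers of P dividing (a) and (b); n = k - l. *)
Definition is_valuation P x (n : int) :=
  exists (a b : K) (k l : nat),
    [/\ x = a / b,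
        ideal_exp P k a /\ ~ ideal_exp P k.+1 a,
        ideal_exp P l b /\ ~ ideal_exp P l.+1 b
      & n = k%:Z - l%:Z].

Definition valuation P x : int := xget 0 [set n | is_valuation P x n].

Definition residue_char P : nat := xget 0%N [set p | prime p /\ P p%:R].

Definition ramification_index P : nat :=
  `|valuation P (residue_char P)%:R|%N.

(* d is the dimension of O_K / P over Z/pZ, p being the residue
   characteristic: b_0, ..., b_(d-1) is a basis modulo P, the coefficients
   in Z/pZ being represented by 0, ..., p - 1. *)
Definition is_residue_degree P (d : nat) :=
  exists b : 'I_d -> K, (forall i, integers (b i)) /\
    forall x, integers x ->
      exists! c : {ffun 'I_d -> 'I_(residue_char P)},
        P (x - \sum_i (c i)%:R * b i).

Definition residue_degree P : nat := xget 0%N [set d | is_residue_degree P d].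

Definition unit_monomial (r : nat) (eps : 'I_r -> K)
    (n : {ffun 'I_r -> int}) : K :=
  \prod_i eps i ^ n i.

Definition fundamental_units (r : nat) (eps : 'I_r -> K) :=
  (forall i, unit_group (eps i)) /\
  (forall u, unit_group u ->
    exists! zn : K * {ffun 'I_r -> int},
      roots_of_unity zn.1 /\ u = zn.1 * unit_monomial eps zn.2).

End Integers.

Section Places.
Variables (R : realType) (K : fieldExtType rat).

Definition real_embeddings : set (K -> R) :=
  [set s : K -> R | exists f : {rmorphism K -> R}, s = f].

Definition nonreal_embeddings : set (K -> R[i]) :=
  [set t : K -> R[i] | (exists f : {rmorphism K -> R[i]}, t = f) /\
           exists x, complex.Im (t x) != 0].

Definition conj_embedding (t : K -> R[i]) : K -> R[i] := fun x => conjc (t x).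

(* Raw carrier; the actual places are the elements of [places] below. *)
Inductive place :=
  | RealPlace of (K -> R)
  | ComplexPlace of set (K -> R[i])
  | FinitePlace of set K.

HB.instance Definition _ := gen_eqMixin place.
HB.instance Definition _ := gen_choiceMixin place.

Definition places : set place := fun v =>
  match v with
  | RealPlace s => real_embeddings s
  | ComplexPlace T =>
      exists2 t, nonreal_embeddings t & T = [set t; conj_embedding t]
  | FinitePlace P => is_maximal_ideal P
  end.

Definition local_degree (v : place) : nat :=
  match v with
  | RealPlace _ => 1%N
  | ComplexPlace _ => 2%N
  | FinitePlace P => (ramification_index P * residue_degree P)%N
  end.

(* At a complex place either of the two conjugate embeddings may be picked:
   they have the same modulus. *)
Definition place_abs (v : place) (x : K) : R :=
  match v with
  | RealPlace s => `|s x|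
  | ComplexPlace T => Normc.normc (xget (fun=> 0) T x)
  | FinitePlace P =>
      if x == 0 then 0 else
      (idealN P)%:R `^
        (- (valuation P x)%:~R / (ramification_index P * residue_degree P)%N%:R)
  end.

Definition height (x : K) : R :=
  \big[*%R/1]_(v \in places) Num.max (place_abs v x ^+ local_degree v) 1.

End Places.

Section Packets.
Variables (R : realType) (K : fieldExtType rat) (B : R).
Variables (h r : nat) (a : 'I_h -> set K) (eps : 'I_r -> K).
Variables (s : 'I_h -> nat) (g : forall l, 'I_(s l) -> K).

Definition bounded_principal (l : 'I_h) (I : set K) :=
  [/\ exists2 x, integers x & I = principal x, is_nonzero I, I `<=` a l
    & (idealN I)%:R <= B * (idealN (a l))%:R].

Definition bounded_generators :=
  forall l,
    (forall i, integers (@g l i) /\ bounded_principal l (principal (@g l i))) /\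
    (forall I, bounded_principal l I -> exists! i, principal (@g l i) = I).

Record packet := Packet {
  pclass : 'I_h;
  pfst : 'I_(s pclass);
  psnd : 'I_(s pclass);
  pexp : {ffun 'I_r -> int}
}.

Definition packet_quot (P : packet) : K := g (pfst P) / g (psnd P).

Definition is_packet (P : packet) :=
  [/\ (pfst P < psnd P)%N,
      gen2 (g (pfst P)) (g (psnd P)) = a (pclass P)
    & (0 < r)%N ->
      height R (unit_monomial eps (pexp P)) <= B * height R (packet_quot P)].

Definition packet_elt (P : packet) : K :=
  unit_monomial eps (pexp P) * packet_quot P.

Definition packet_set (P : packet) : set K :=
  [set z * packet_elt P | z in @roots_of_unity K] `|`
  [set z / packet_elt P | z in @roots_of_unity K].

End Packets.

(* Main.v *)
(* A pair of integers x, y with x, y != 0 satisfies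
     height (x / y) = prod_s max(|s x|, |s y|) / N((x, y)),
   s running over the embeddings of K into the complex numbers.  Hence the height
   is invariant under inversion and under roots of unity, it is submultiplicative,
   and N((x)), N((y)) <= height (x / y) N((x, y)).  If c a_l = (x, 1), then
   a_l = (x / c, 1 / c), so that x / c and 1 / c are unit multiples of generators
   g_i, g_j; this gives the packet of x.  Conversely the ideal (g_i, g_j) = a_l and
   the quotient g_i / g_j up to units determine l, i and j, because an element that
   stabilizes a_l is an integer.

   The formula follows from N((x)) = prod_s |s x| (the index of a sublattice of an
   integral basis) and from unique factorization of ideals.  Invertibility of
   ideals comes from the finiteness of the set of classes, which is part of the
   hypotheses: two powers of an ideal lie in the same class. *)
Require Import Defs.
From HB Require Import structures.
From mathcomp Require Import all_boot all_order all_algebra all_field.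
From mathcomp Require Import fingroup perm complex finmap.
From mathcomp Require Import all_classical all_reals exp.
From mathcomp Require Import ring zify.

Set Implicit Arguments.
Unset Strict Implicit.
Unset Printing Implicit Defensive.

Import Order.TTheory GRing.Theory Num.Theory.
Local Open Scope classical_set_scope.
Local Open Scope ring_scope.

(** * Complex embeddings *)

(** The embeddings are taken in two fields. Integrality of discriminants is seen in [algC], where a
    rational algebraic integer is an integer; heights are computed in [R[i]]. The norm of a
    principal ideal is therefore computed for every family of [\dim {:K}] embeddings separated by
    one element.

    Norms, being cardinals of residue systems, also replace chain conditions: a maximal ideal above
    I is a proper ideal of least norm containing I, and ideals are factored by induction on the
    norm.

    The exponent bound of a packet comes from the calculus of heights. If x = w e q with w a root of
    unity, e a monomial in the fundamental units and q = g_i / g_j, then e = w^-1 x q^-1, so H(e) <=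
    H(x) H(q) <= B H(q). If i = j then x is a unit. The case i > j is the reason why F(P) contains
    inverses: it is then 1 / x whose indices are in the right order. *)

Section Embeddings.
Variables (K : fieldExtType rat) (C : numClosedFieldType).

(** In characteristic zero K is separable over [rat], so it has a separable generator; [p] is its
    minimal polynomial with coefficients read in [rat]. *)
Lemma primitive_element : exists (t : K) (p : {poly rat}),
  [/\ forall x, exists q : {poly rat}, x = (map_poly (in_alg K) q).[t],
      p \is monic, size p = (\dim {:K}).+1, separable_poly p &
      forall q, root (map_poly (in_alg K) q) t = (p %| q)].
Proof.
have sepK : separable 1 {:K}.
  apply/separableP => y _; apply: pcharf0_separable => q /=.
  by rewrite (pchar_lalg K) pchar_num.
exists (separable_generator 1 {:K}).
set t := separable_generator _ _.
have defK : <<1; t>>%VS = fullv by rewrite -eq_adjoin_separable_generator ?subvf.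
have [p pE] := polyOver1P (minPolyOver 1 t); exists p; split.
- move=> x; have : x \in <<1; t>>%VS by rewrite defK memvf.
  by case/Fadjoin1_polyP => q ->; exists q.
- by rewrite -(map_monic (in_alg K)) -pE monic_minPoly.
- rewrite -(size_map_poly (in_alg K)) -pE size_minPoly -defK dim_Fadjoin.
  by rewrite dimv1 muln1.
- have := separable_generatorP {:K} 1.
  by rewrite /separable_element -/t pE separable_map.
move=> q; apply/idP/idP => [q0|].
  rewrite -(dvdp_map (in_alg K)) -pE minPoly_dvdp //.
  by apply/polyOver1P; exists q.
rewrite -(dvdp_map (in_alg K)) -pE -!dvdp_XsubCl; apply: dvdp_trans.
by rewrite dvdp_XsubCl root_minPoly.
Qed.

Lemma rmorph_map_ratr (f : {rmorphism K -> C}) (q : {poly rat}) x :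
  f (map_poly (in_alg K) q).[x] = (map_poly ratr q).[f x].
Proof.
rewrite -horner_map -map_poly_comp; congr (_.[_]).
exact/eq_map_poly/(fmorph_eq_rat (f \o in_alg K)).
Qed.

(** An element is written as a polynomial in [t], which is then evaluated at [z]; two such
    polynomials differ by a multiple of [p], which vanishes at [z]. *)
Lemma embedding_of_root (t : K) (p : {poly rat}) (z : C) :
    (forall x, exists q : {poly rat}, x = (map_poly (in_alg K) q).[t]) ->
    (forall q, root (map_poly (in_alg K) q) t = (p %| q)) ->
    root (map_poly ratr p) z ->
  exists f : {rmorphism K -> C}, f t = z.
Proof.
move=> /choice[q qE] ker_t pz.
pose f x := (map_poly ratr (q x)).[z].
have fE x u : x = (map_poly (in_alg K) u).[t] -> f x = (map_poly ratr u).[z].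
  move=> xE; apply/eqP; rewrite -subr_eq0 -hornerN -hornerD -raddfB -rootE.
  move: pz; rewrite -!dvdp_XsubCl => /dvdp_trans; apply; rewrite dvdp_map -ker_t rootE raddfB hornerD hornerN.
  by rewrite -qE -xE subrr.
have fB : zmod_morphism f.
  by move=> x y; rewrite (fE _ (q x - q y)) raddfB hornerD hornerN -?qE.
have fM : monoid_morphism f.
  split=> [|x y]; first by rewrite (fE _ 1) rmorph1 hornerC.
  by rewrite (fE _ (q x * q y)) rmorphM hornerM -?qE.
pose fA := GRing.isZmodMorphism.Build K C f fB.
pose fMM := GRing.isMonoidMorphism.Build K C f fM.
pose F : {rmorphism K -> C} := HB.pack f fA fMM.
by exists F; rewrite /= (fE _ 'X) map_polyX hornerX.
Qed.

(** A separable polynomial has as many distinct roots in [C] as its degree, and each root gives an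
    embedding. That a single [t] separates them makes the Vandermonde determinants below nonzero. *)
Lemma exists_embeddings :
  exists (t : K) (s : 'I_(\dim {:K}) -> {rmorphism K -> C}),
    injective (fun i => s i t) /\
    forall f : {rmorphism K -> C}, exists i, f =1 s i.
Proof.
have [t [p [tgen monp szp sepp ker_t]]] := primitive_element; exists t.
have [r rE] := closed_field_poly_normal (map_poly ratr p : {poly C}).
have monpC : map_poly ratr p \is @monic C by rewrite map_monic.
rewrite (monicP monpC) scale1r in rE.
have szr : size r = \dim {:K}.
  by apply/succn_inj; rewrite -szp -(size_map_poly (@ratr C)) rE size_prod_XsubC.
have ur : uniq r by rewrite -separable_prod_XsubC -rE separable_map.
have /choice[s sE] (i : 'I_(\dim {:K})) : exists f : {rmorphism K -> C}, f t = r`_i.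
  apply: embedding_of_root tgen ker_t _.
  by rewrite rE root_prod_XsubC mem_nth ?szr.
exists s; split=> [i j|f].
  by rewrite !sE => /eqP; rewrite nth_uniq ?szr // => /eqP/val_inj.
have : root (map_poly ratr p) (f t).
  by rewrite rootE -rmorph_map_ratr (rootP _) ?rmorph0 // ker_t.
rewrite rE root_prod_XsubC => ftr.
have idx : (index (f t) r < \dim {:K})%N by rewrite -szr index_mem.
exists (Ordinal idx) => x; have [q ->] := tgen x.
by rewrite !rmorph_map_ratr sE /= nth_index.
Qed.

End Embeddings.

(** * Integers *)

Section IntegerRing.
Variable K : fieldExtType rat.
Implicit Types x y : K.
Local Notation OK := (@integers K).

Lemma integers0 : OK 0. Proof. exact: integral0. Qed.
Lemma integers1 : OK 1. Proof. exact: integral1. Qed.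
Lemma integersB x y : OK x -> OK y -> OK (x - y). Proof. exact: integral_sub. Qed.
Lemma integersD x y : OK x -> OK y -> OK (x + y). Proof. exact: integral_add. Qed.
Lemma integersM x y : OK x -> OK y -> OK (x * y). Proof. exact: integral_mul. Qed.
Lemma integersN x : OK x -> OK (- x). Proof. exact: integral_opp. Qed.
Lemma integers_int (z : int) : OK z%:~R. Proof. exact: integral_id. Qed.
Lemma integers_nat n : OK n%:R. Proof. exact: integral_nat. Qed.

Lemma integers_sum I (r : seq I) (P : pred I) (F : I -> K) :
  (forall i, P i -> OK (F i)) -> OK (\sum_(i <- r | P i) F i).
Proof. by move=> FO; apply: (big_ind OK) => //; [apply: integers0|apply: integersD]. Qed.

Lemma integers_prod I (r : seq I) (P : pred I) (F : I -> K) :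
  (forall i, P i -> OK (F i)) -> OK (\prod_(i <- r | P i) F i).
Proof. by move=> FO; apply: (big_ind OK) => //; [apply: integers1|apply: integersM]. Qed.

Lemma integersX x n : OK x -> OK (x ^+ n).
Proof.
by move=> Ox; elim: n => [|n IH]; rewrite ?exprS; [apply: integers1|apply: integersM].
Qed.

(** [y] is an eigenvalue of an integer matrix, hence a root of a monic integer polynomial. The
    transpose appears because [eigenvalue] acts on row vectors. *)
Lemma integral_of_stable_span n (m : 'I_n -> K) (A : 'M[int]_n) y :
    (exists i, m i != 0) ->
    (forall i, y * m i = \sum_j (A i j)%:~R * m j) ->
  OK y.
Proof.
move=> [i0 mi0] mE; exists (char_poly A^T); first exact: char_poly_monic.
rewrite map_char_poly -eigenvalue_root_char.
apply/eigenvalueP; exists (\row_i m i).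
  apply/rowP => i; rewrite !mxE mE; apply: eq_bigr => j _.
  by rewrite !mxE mulrC.
by apply/eqP => /rowP/(_ i0)/eqP; rewrite !mxE (negbTE mi0).
Qed.

Lemma common_denominator (I : finType) (q : I -> rat) :
  exists m : nat, (0 < m)%N /\ forall i, exists z : int, m%:R * q i = z%:~R.
Proof.
exists (absz (\prod_i denq (q i))); split.
  by rewrite absz_gt0; apply/prodf_neq0 => i _; apply: denq_neq0.
move=> i; exists (numq (q i) * \prod_(j | j != i) denq (q j)).
rewrite pmulrn gez0_abs ?prodr_ge0 // (bigD1 i) //= !intrM numqE.
by rewrite mulrAC [q i * _]mulrC.
Qed.

Lemma rat_span_vbasis x : exists q : 'I_(\dim {:K}) -> rat,
  x = \sum_j q j *: (vbasis {:K})`_j.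
Proof.
exists (fun j => coord (vbasis {:K}) j x).
by apply: coord_vbasis; apply: memvf.
Qed.

(** With [m] a common denominator of the matrix of multiplication by [x] in a basis over [rat], the
    element [m%:R * x] acts on this basis by an integer matrix. *)
Lemma clear_denominator x : exists m : nat, (0 < m)%N /\ OK (m%:R * x).
Proof.
have /choice[q qE] (i : 'I_(\dim {:K})) := rat_span_vbasis (x * (vbasis {:K})`_i).
have [m [m0 mq]] := common_denominator (fun ij : 'I_(\dim {:K}) * 'I_(\dim {:K}) => q ij.1 ij.2).
exists m; split => //; have /choice[z zE] := mq.
apply: (@integral_of_stable_span _ (fun i => (vbasis {:K})`_i)
                                 (\matrix_(i, j) z (i, j))).
  have dK : (0 < \dim {:K})%N by rewrite adim_gt0.
  exists (Ordinal dK) => /=; apply/eqP => b0.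
  have b_in : (vbasis {:K})`_0 \in vbasis {:K} by apply: mem_nth; rewrite size_tuple.
  by have := basis_not0 (vbasisP {:K}) b_in; rewrite b0 eqxx.
move=> i; rewrite -mulrA qE mulr_sumr; apply: eq_bigr => j _.
rewrite mxE -mulr_algl mulrA; congr (_ * _).
by rewrite -(rmorph_int (in_alg K)) -zE rmorphM rmorph_nat.
Qed.

Lemma Aint_embedding (f : {rmorphism K -> algC}) x : OK x -> f x \in Aint.
Proof.
case=> p monp px.
have : root (map_poly intr p) (f x).
  have -> : map_poly intr p = map_poly f (map_poly intr p).
    by rewrite -map_poly_comp; apply: eq_map_poly => z /=; rewrite rmorph_int.
  by rewrite fmorph_root.
move/root_monic_Aint; apply; first by rewrite monic_map.
by apply/polyOverP => i; rewrite coef_map /= intr_int.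
Qed.

End IntegerRing.

(** * Integral bases *)

Section EmbeddingMatrix.
Variables (K : fieldExtType rat) (C : numClosedFieldType).
Local Notation n := (\dim {:K}).
Variable s : 'I_n -> {rmorphism K -> C}.

(** The square of its determinant is the discriminant of the family [b]. *)
Definition embedding_mx (b : 'I_n -> K) : 'M[C]_n := \matrix_(i, j) s i (b j).

Lemma embeddingZ (f : {rmorphism K -> C}) (q : rat) x : f (q *: x) = ratr q * f x.
Proof.
rewrite -mulr_algl rmorphM; congr (_ * _).
exact: (fmorph_eq_rat (f \o in_alg K)).
Qed.

Lemma embedding_mx_comb (b c : 'I_n -> K) (A : 'M[rat]_n) :
    (forall j, c j = \sum_k A j k *: b k) ->
  embedding_mx c = embedding_mx b *m (map_mx ratr A)^T.
Proof.
move=> cE; apply/matrixP => i j; rewrite !mxE cE raddf_sum; apply: eq_bigr => k _.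
by rewrite /= embeddingZ !mxE mulrC.
Qed.

Lemma embedding_mx_scale (b : 'I_n -> K) x :
  embedding_mx (fun j => x * b j) = diag_mx (\row_i s i x) *m embedding_mx b.
Proof. by rewrite mul_diag_mx; apply/matrixP => i j; rewrite !mxE rmorphM. Qed.

(** A rational relation among the [b j] is a kernel vector of the embedding matrix, so the family is
    free, and it has as many members as the dimension. *)
Lemma embedding_mx_span (b : 'I_n -> K) : \det (embedding_mx b) != 0 ->
  forall x, exists q : 'I_n -> rat, x = \sum_j q j *: b j.
Proof.
move=> db x; pose X := [tuple b i | i < n].
have XE (i : 'I_n) : X`_i = b i by rewrite (nth_map i) ?size_enum_ord // nth_ord_enum.
have freeX : free X.
  apply/freeP => k k0 i; pose v : 'cV[C]_n := \col_j ratr (k j).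
  have Sv : embedding_mx b *m v = 0.
    apply/colP => l; rewrite !mxE -[RHS](rmorph0 (s l)) -k0 raddf_sum.
    by apply: eq_bigr => j _; rewrite /= embeddingZ XE !mxE mulrC.
  have /eqP := congr1 (mulmx (invmx (embedding_mx b))) Sv.
  rewrite mulKmx ?unitmxE ?unitfE // mulmx0 => /eqP/colP/(_ i).
  by rewrite !mxE => /eqP; rewrite fmorph_eq0 => /eqP.
have bX : basis_of {:K} X by rewrite basisEfree freeX subvf size_tuple leqnn.
exists (fun j => coord X j x).
apply: (etrans (coord_basis bX (memvf x))); apply: eq_bigr => j _.
by rewrite XE.
Qed.

Hypothesis s_inj : exists t, injective (fun i => s i t).

(** The matrix of the powers of a separating element is a Vandermonde matrix with distinct nodes,
    and it factors through the matrix of the spanning family [b]. *)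
Lemma span_embedding_mx (b : 'I_n -> K) :
    (forall x, exists q : 'I_n -> rat, x = \sum_j q j *: b j) ->
  \det (embedding_mx b) != 0.
Proof.
case: s_inj => t t_inj bspan.
have /choice[q qE] (k : 'I_n) := bspan (t ^+ k).
have VE := @embedding_mx_comb b (fun k => t ^+ k) (\matrix_(i, j) q i j).
have : \det (embedding_mx (fun k => t ^+ k)) != 0.
  have -> : embedding_mx (fun k => t ^+ k) = (Vandermonde n (\row_i s i t))^T.
    by apply/matrixP => i j; rewrite !mxE rmorphXn.
  rewrite det_tr det_Vandermonde; apply/prodf_neq0 => i _; apply/prodf_neq0 => j ij.
  rewrite !mxE subr_eq0; apply: contraTneq ij => /t_inj ->.
  by rewrite ltnn.
rewrite VE; last by move=> j; rewrite qE; apply: eq_bigr => k _; rewrite mxE.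
by rewrite det_mulmx; apply: contraNneq => ->; rewrite mul0r.
Qed.

(** The embedding matrix conjugates the transpose of [A], the matrix of multiplication by [x], into
    the diagonal matrix of the conjugates of [x]. *)
Lemma embedding_norm_trace (b : 'I_n -> K) x (A : 'M[rat]_n) :
    \det (embedding_mx b) != 0 ->
    (forall j, x * b j = \sum_k A j k *: b k) ->
  ratr (\det A) = \prod_i s i x /\ ratr (\tr A) = \sum_i s i x.
Proof.
move=> db xb; have bu : embedding_mx b \in unitmx by rewrite unitmxE unitfE.
have := embedding_mx_comb xb; rewrite embedding_mx_scale => DE.
have DA : diag_mx (\row_i s i x) = embedding_mx b *m (map_mx ratr A)^T *m invmx (embedding_mx b).
  by rewrite -DE mulmxK.
split.
  apply: (mulIf db); rewrite -det_map_mx -det_tr mulrC -det_mulmx -DE det_mulmx.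
  by rewrite det_diag; congr (_ * _); apply: eq_bigr => i _; rewrite mxE.
have <- : \tr (diag_mx (\row_i s i x)) = \sum_i s i x.
  by rewrite mxtrace_diag; apply: eq_bigr => i _; rewrite mxE.
rewrite DA mxtrace_mulC mulmxA mulVmx // mul1mx mxtrace_tr.
by rewrite /mxtrace raddf_sum; apply: eq_bigr => i _; rewrite mxE.
Qed.

End EmbeddingMatrix.

Section IntegralBasis.
Variable K : fieldExtType rat.
Local Notation n := (\dim {:K}).
Local Notation OK := (@integers K).

(** The product of the embedding matrix by its transpose on the left has the traces of the
    [b j * b k] as entries. They are rational, as traces of rational matrices, and algebraic
    integers, as sums of conjugates of integers. *)
Lemma disc_int (s : 'I_n -> {rmorphism K -> algC}) (b : 'I_n -> K) :
    (forall i, OK (b i)) -> \det (embedding_mx s b) != 0 ->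
  \det (embedding_mx s b) ^+ 2 \is a Num.int.
Proof.
move=> bO db; set S := embedding_mx s b.
have -> : \det S ^+ 2 = \det (S^T *m S) by rewrite det_mulmx det_tr.
suffices H j k : (S^T *m S) j k \is a Num.int.
  rewrite /determinant rpred_sum // => p _; rewrite rpredM ?rpred_prod //.
  by rewrite rpredX // rpredN rpred1.
have -> : (S^T *m S) j k = \sum_i s i (b j * b k).
  by rewrite !mxE; apply: eq_bigr => i _; rewrite !mxE rmorphM.
apply: Cint_rat_Aint.
  have /choice[q qE] (i : 'I_n) := embedding_mx_span db (b j * b k * b i).
  have [|_ <-] := @embedding_norm_trace _ _ s b (b j * b k) (\matrix_(i, l) q i l) db.
    by move=> i; rewrite qE; apply: eq_bigr => l _; rewrite mxE.
  exact: Crat_rat.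
by apply: rpred_sum => i _; apply: Aint_embedding; apply: integersM.
Qed.

Lemma nondegenerate_integral_family (s : 'I_n -> {rmorphism K -> algC}) :
    (exists t, injective (fun i => s i t)) ->
  exists b : 'I_n -> K, (forall i, OK (b i)) /\ \det (embedding_mx s b) != 0.
Proof.
case=> t t_inj; have [m [m0 mt]] := clear_denominator t.
have mC : m%:R != 0 :> algC by rewrite pnatr_eq0 -lt0n.
exists (fun k => (m%:R * t) ^+ k); split=> [i|]; first exact: integersX.
have -> : embedding_mx s (fun k => (m%:R * t) ^+ k)
        = (Vandermonde n (\row_i s i (m%:R * t)))^T.
  by apply/matrixP => i j; rewrite !mxE rmorphXn.
rewrite det_tr det_Vandermonde; apply/prodf_neq0 => i _; apply/prodf_neq0 => j ij.
rewrite !mxE !rmorphM !rmorph_nat subr_eq0; apply: contraTneq ij => /(mulfI mC).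
by move/t_inj ->; rewrite ltnn.
Qed.

Lemma det_replace_col (F : comNzRingType) k (A : 'M[F]_k) (j : 'I_k) :
  (forall i l, l != j -> A i l = (i == l)%:R) -> \det A = A j j.
Proof.
move=> AE; rewrite (expand_det_row A j) (bigD1 j) //= big1 ?addr0.
  rewrite /cofactor addnn -signr_odd odd_double mul1r.
  suffices -> : row' j (col' j A) = 1%:M by rewrite det1 mulr1.
  apply/matrixP => u v; rewrite !mxE AE; last by rewrite eq_sym neq_lift.
  by rewrite (inj_eq (@lift_inj _ j)).
by move=> l lj; rewrite AE // eq_sym (negbTE lj) mul0r.
Qed.

(* A family of integers that generates K over rat and whose discriminant is
   smallest in absolute value generates the ring of integers: replacing b_j by
   x - floor(q_j) b_j, where q_j is the j-th coordinate of an integer x,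
   multiplies the discriminant by the square of the fractional part of q_j. *)
Lemma integral_basis : exists b : 'I_n -> K,
  [/\ forall i, OK (b i),
      forall x, exists q : 'I_n -> rat, x = \sum_j q j *: b j &
      forall x, OK x -> exists z : 'I_n -> int, x = \sum_j (z j)%:~R * b j].
Proof.
have [t [s [t_inj _]]] := exists_embeddings K algC.
pose P m := `[< exists b : 'I_n -> K, [/\ forall i, OK (b i),
  \det (embedding_mx s b) != 0 & `|\det (embedding_mx s b) ^+ 2| = m%:R] >].
(* The absolute value of an integral discriminant is a natural number, which is what allows a
   minimal one to be chosen. *)
have Pb b : (forall i, OK (b i)) -> \det (embedding_mx s b) != 0 ->
    exists2 m, P m & `|\det (embedding_mx s b) ^+ 2| = m%:R.
  move=> bO db; have /intrP[z zE] := disc_int bO db.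
  exists (absz z); last by rewrite zE -intr_norm -abszE.
  by apply/asboolP; exists b; split => //; rewrite zE -intr_norm -abszE.
have exP : exists m, P m.
  have [|b [bO db]] := @nondegenerate_integral_family s; first by exists t.
  by have [m Pm _] := Pb b bO db; exists m.
case: (ex_minnP exP) => m /asboolP[b [bO db bm]] m_min.
exists b; split => //; first exact: embedding_mx_span db.
move=> x Ox; have [q qE] := embedding_mx_span db x.
suffices qz j : q j = (Num.floor (q j))%:~R.
  exists (fun j => Num.floor (q j)); rewrite qE; apply: eq_bigr => j _.
  by rewrite {1}qz scaler_int mulrzl.
apply/eqP; rewrite -subr_eq0; apply/eqP/eqP/negPn/negP => fj.
set f := q j - _ in fj.
have f0 : 0 < f.
  by rewrite lt0r fj subr_ge0 floor_le.
have f1 : f < 1 by rewrite ltrBlDl -[ltRHS](intrD _ _ 1) floorD1_gt.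
pose y := x - (Num.floor (q j))%:~R * b j.
pose c k := if k == j then y else b k.
pose A : 'M[rat]_n := \matrix_(k, l)
  if k == j then (if l == j then f else q l) else (k == l)%:R.
have cE k : c k = \sum_l A k l *: b l.
  rewrite /c; case: eqP => [->|/eqP kj].
    rewrite /y qE (bigD1 j) //= [RHS](bigD1 j) //= !mxE !eqxx /f scalerBl.
    rewrite scaler_int mulrzl addrAC; congr (_ + _).
    by apply: eq_bigr => l lj; rewrite !mxE eqxx (negbTE lj).
  rewrite (bigD1 k) //= big1 ?addr0 => [|l lk]; rewrite !mxE (negbTE kj).
    by rewrite eqxx scale1r.
  by rewrite eq_sym (negbTE lk) scale0r.
have detA : \det A = f.
  rewrite -det_tr (@det_replace_col _ _ _ j) ?mxE ?eqxx // => k l lj.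
  by rewrite !mxE (negbTE lj) eq_sym.
have dc : \det (embedding_mx s c) = \det (embedding_mx s b) * ratr f.
  by rewrite (embedding_mx_comb _ cE) det_mulmx det_tr det_map_mx detA.
have cO k : OK (c k).
  rewrite /c; case: eqP => // _; apply: integersB => //.
  by apply: integersM => //; apply: integers_int.
have dc0 : \det (embedding_mx s c) != 0.
  by rewrite dc mulf_neq0 // fmorph_eq0.
have [m' Pm' m'E] := Pb c cO dc0.
have := m_min _ Pm'; apply/negP; rewrite -ltnNge -(ltr_nat algC) -m'E -bm dc.
rewrite exprMn normrM gtr_pMr ?normr_gt0 ?expf_neq0 // -rmorphXn /=.
rewrite ger0_norm; last by rewrite ler0q exprn_ge0 // ltW.
by rewrite -[ltRHS](ratr_nat _ 1) ltr_rat exprn_ilt1 // ltW.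
Qed.

End IntegralBasis.

(** * Residue systems and norms of principal ideals *)

Section ResidueSystems.
Variable K : fieldExtType rat.
Implicit Types (I : set K) (x y : K).
Local Notation OK := (@integers K).

(** Representatives indexed by a finite type turn [idealN] into the cardinal of that type. *)
Definition residue_system I (T : finType) (e : T -> K) :=
  (forall t, OK (e t)) /\ forall x, OK x -> exists! t, I (x - e t).

Local Notation coset x I := [set x + y | y in I].

Lemma eq_coset I x y : is_submodule I -> coset x I = coset y I <-> I (x - y).
Proof.
case=> I0 IB _; split=> [/seteqP[/(_ x) sub _]|Ixy].
  have [|z Iz] := sub; first by exists 0; rewrite ?addr0.
  by move=> <-; rewrite addrC addKr.
have Iyx : I (y - x) by rewrite -opprB -sub0r; apply: IB.
apply/seteqP; split=> _ [z Iz <-].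
  by exists (z - (y - x)); [apply: IB|rewrite opprB addrCA subrKC addrC].
by exists (z - (x - y)); [apply: IB|rewrite opprB addrCA subrKC addrC].
Qed.

Lemma residue_systemP I (T : finType) (e : T -> K) :
  is_submodule I -> residue_system I e -> finite_set (cosets I) /\ idealN I = #|T|.
Proof.
move=> subI [eO e_uniq]; pose f t := coset (e t) I.
have fE : cosets I = f @` setT.
  apply/seteqP; split=> [_ [x Ox <-]|_ [t _ <-]]; last by exists (e t).
  have [t [It _]] := e_uniq x Ox; exists t => //.
  by apply/eq_coset; rewrite // -opprB -sub0r; case: subI => I0 IB _; apply: IB.
have f_inj : injective f.
  move=> t t' /(eq_coset _ _ subI) It.
  have [u [_ uu]] := e_uniq (e t) (eO t).
  by rewrite -(uu t') // -(uu t) // subrr; case: subI.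
have fin : finite_set (cosets I) by rewrite fE; apply: finite_image.
split=> //; rewrite /idealN cardE -(size_map f); apply/perm_size/uniq_perm => //.
  by rewrite map_inj_uniq ?enum_uniq.
move=> C; rewrite in_fset_set //; apply/idP/mapP => [|[t _ ->]].
  by rewrite inE fE => -[t _ <-]; exists t; rewrite ?mem_enum.
by rewrite inE fE; exists t.
Qed.

Lemma exists_residue_system I : is_submodule I -> finite_set (cosets I) ->
  exists e : 'I_(idealN I) -> K, residue_system I e.
Proof.
move=> subI fin; set X := fset_set (cosets I).
have XP C : (C \in X) = `[< cosets I C >] by rewrite in_fset_set.
have XiP (i : 'I_(idealN I)) : exists x, OK x /\ nth set0 X i = coset x I.
  have : nth set0 X i \in X by apply: mem_nth.
  by rewrite XP => /asboolP[x Ox <-]; exists x.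
have /choice[e eP] := XiP; exists e; split=> [t|x Ox]; first by case: (eP t).
have xX : coset x I \in X by rewrite XP; apply/asboolP; exists x.
have idx : (index (coset x I) X < idealN I)%N by rewrite index_mem.
exists (Ordinal idx); split=> [|t It].
  by apply/eq_coset; rewrite // -(eP _).2 /= nth_index.
have xE : coset x I = nth set0 X t by rewrite (eP t).2; apply/eq_coset.
by apply/val_inj; rewrite /= xE index_uniq ?fset_uniq //; apply: ltn_ord t.
Qed.

Lemma finite_cosets_cover I (T : finType) (e : T -> K) : is_submodule I ->
  (forall x, OK x -> exists t, I (x - e t)) -> finite_set (cosets I).
Proof.
move=> subI cover; apply: (@sub_finite_set _ _ ((fun t => coset (e t) I) @` setT)).
  by move=> _ [x Ox <-]; have [t It] := cover x Ox; exists t => //; apply/esym/eq_coset.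
exact: finite_image.
Qed.

Lemma finite_cosetsS I J : is_submodule I -> is_submodule J ->
  I `<=` J -> finite_set (cosets I) -> finite_set (cosets J).
Proof.
move=> subI subJ IJ finI; have [e [_ e_uniq]] := exists_residue_system subI finI.
apply: (finite_cosets_cover (e := e)) => // x Ox.
by have [t [/IJ It _]] := e_uniq x Ox; exists t.
Qed.

(** Sending a representative modulo [J] to its representative modulo [I] is injective. If the
    cardinals force it to be onto, the classes modulo [I] of [x] in [J] and of 0 both come from the
    zero class modulo [J], hence coincide. *)
Lemma idealNS I J : is_submodule I -> is_submodule J ->
    I `<=` J -> finite_set (cosets I) ->
  (idealN J <= idealN I)%N /\
  (J `<=` OK -> (idealN I <= idealN J)%N -> J `<=` I).
Proof.
move=> subI subJ IJ finI; have finJ := finite_cosetsS subI subJ IJ finI.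
have [J0 JB _] := subJ.
have [e [eO e_uniq]] := exists_residue_system subI finI.
have [f [fO f_uniq]] := exists_residue_system subJ finJ.
have /choice[h hP] t : exists u, I (f t - e u).
  by have [u [Iu _]] := e_uniq _ (fO t); exists u.
have f_inj t t' : J (f t - f t') -> t = t'.
  move=> Jtt'; have [u [_ uu]] := f_uniq _ (fO t).
  by rewrite -(uu t) ?(uu t') // subrr.
have h_inj : injective h.
  move=> t t' htt'; apply: f_inj.
  have -> : f t - f t' = (f t - e (h t)) - (f t' - e (h t')) by rewrite htt'; ring.
  by apply: JB; apply/IJ/hP.
split=> [|JO leN x Jx]; first by have := leq_card h h_inj; rewrite !card_ord.
have h_onto u : exists t, h t = u.
  have /codomP[t ->] : u \in codom h by apply: inj_card_onto; rewrite ?card_ord.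
  by exists t.
have [u [Iu _]] := e_uniq x (JO x Jx).
have [v [Iv _]] := e_uniq 0 (integers0 K).
have [[t tu] [t' t'v]] := (h_onto u, h_onto v).
have Jt : J (f t).
  have -> : f t = (f t - e (h t)) - ((x - e u) - x) by rewrite tu; ring.
  by apply: (JB _ _ (IJ _ (hP t))); apply: JB => //; apply: IJ.
have Jt' : J (f t').
  have -> : f t' = (f t' - e (h t')) - (0 - e v) by rewrite t'v; ring.
  by apply: (JB _ _ (IJ _ (hP t'))); apply: IJ.
have tt' : t = t' by apply: f_inj; apply: JB.
have [_ IB _] := subI.
have -> : x = (x - e u) - (0 - e v) by rewrite -tu -t'v tt'; ring.
exact: IB.
Qed.

End ResidueSystems.

(** * Index of a sublattice of full rank *)

Section LatticeIndex.

Lemma absz_unit (u : int) : u \is a GRing.unit -> absz u = 1%N.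
Proof. by rewrite unfold_in /= => /orP[] /eqP ->. Qed.

Lemma int_residue (z d : int) : d != 0 ->
  exists! k : 'I_(absz d), (d %| z - (k : nat)%:Z)%Z.
Proof.
move=> d0; have lt_zd : (absz (z %% d)%Z < absz d)%N.
  by rewrite -ltz_nat !abszE ger0_norm ?modz_ge0 ?ltz_mod.
have mE : (absz (z %% d)%Z)%:Z = (z %% d)%Z by rewrite gez0_abs ?modz_ge0.
exists (Ordinal lt_zd); split=> [|k].
  by rewrite /= mE -eqz_mod_dvd modz_mod.
rewrite -eqz_mod_dvd => /eqP zk; apply/val_inj => /=; apply/eqP.
by rewrite -eqz_nat mE zk -modz_abs modz_nat modn_small.
Qed.

Lemma diag_residues n (d : 'I_n -> int) : (forall i, d i != 0) ->
  exists (T : finType) (e : T -> 'rV[int]_n), #|T| = absz (\prod_i d i) /\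
    forall v, exists! t, exists w : 'rV[int]_n, v - e t = \row_i (w 0 i * d i).
Proof.
move=> d0; pose T : finType := {dffun forall i : 'I_n, 'I_(absz (d i))}.
exists T, (fun t : T => \row_i (t i : nat)%:Z); split.
  rewrite card_dep_ffun foldrE big_image /= (big_morph absz abszM (erefl _)).
  by apply: eq_bigr => i _; rewrite card_ord.
move=> v; have /fin_all_exists[t tP] (i : 'I_n) := int_residue (v 0 i) (d0 i).
exists [ffun i => t i]; split=> [|t' [w wE]].
  have /fin_all_exists[w wE] (i : 'I_n) : exists c, v 0 i - (t i : nat)%:Z = c * d i.
    by have [/dvdzP[c ->] _] := tP i; exists c.
  by exists (\row_i w i); apply/rowP => i; rewrite !mxE ffunE wE.
apply/ffunP => i; rewrite ffunE; have [_ ti] := tP i; apply: ti.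
by move/rowP/(_ i): wE; rewrite !mxE => ->; apply: dvdz_mull.
Qed.

(** In the Smith form A = L D U the unimodular L does not change the row lattice of D U, and U is an
    automorphism of the ambient lattice, so the residues are those of the diagonal matrix D. *)
Lemma lattice_residues n (A : 'M[int]_n) : \det A != 0 ->
  exists (T : finType) (e : T -> 'rV[int]_n), #|T| = absz (\det A) /\
    forall v, exists! t, exists w, v - e t = w *m A.
Proof.
have [L uL [U uU [d _ AE]]] := int_Smith_normal_form A.
(* If [d] is shorter than [n], the missing entries are read as 0; the nonzero determinant excludes
   this in [di0]. *)
set D := (\matrix_(i, j) _) in AE; pose di (i : 'I_n) := d`_i.
have DE (w : 'rV[int]_n) : w *m D = \row_i (w 0 i * di i).
  apply/rowP => i; rewrite !mxE (bigD1 i) //= big1 => [|j ji].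
    by rewrite mxE eqxx mulr1n addr0.
  by rewrite mxE (inj_eq val_inj) (negbTE ji) mulr0n mulr0.
have detD : \det D = \prod_i di i.
  have -> : D = diag_mx (\row_i di i).
    apply/matrixP => i j; rewrite !mxE (inj_eq val_inj).
    by case: eqP => [->|].
  by rewrite det_diag; apply: eq_bigr => i _; rewrite mxE.
have absA : absz (\det A) = absz (\prod_i di i).
  move: (uL) (uU); rewrite !unitmxE => uL' uU'.
  rewrite AE !det_mulmx !abszM detD.
  by rewrite (absz_unit uL') (absz_unit uU') mul1n muln1.
move=> dA; have di0 i : di i != 0.
  apply: contraNneq dA => di0; rewrite -absz_eq0 absA absz_eq0.
  by rewrite (bigD1 i) //= di0 mul0r.
have [T [e [cT eP]]] := diag_residues di0.
exists T, (fun t => e t *m U); split=> [|v]; first by rewrite cT absA.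
have eqv t : (exists w, v - e t *m U = w *m A) <->
    (exists w : 'rV_n, v *m invmx U - e t = \row_i (w 0 i * di i)).
  split=> [[w wE]|[w wE]].
    exists (w *m L); rewrite -DE -[e t](mulmxK uU) -mulmxBl wE AE !mulmxA.
    by rewrite mulmxK.
  exists (w *m invmx L); rewrite AE !mulmxA mulmxKV // DE -wE mulmxBl.
  by rewrite mulmxKV.
have [t [tP tu]] := eP (v *m invmx U); exists t; split; first exact/eqv.
by move=> t' /eqv; apply: tu.
Qed.

End LatticeIndex.

Section PrincipalIndex.
Variable K : fieldExtType rat.
Local Notation n := (\dim {:K}).
Local Notation OK := (@integers K).

Lemma principal_submodule (x : K) : is_submodule (principal x).
Proof.
split; first by exists 0; [apply: integers0|rewrite mul0r].
  move=> _ _ [c Oc <-] [d Od <-]; exists (c - d); last by rewrite mulrBl.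
  exact: integersB.
move=> c _ Oc [d Od <-]; exists (c * d); last by rewrite mulrA.
exact: integersM.
Qed.

(** Coordinates in an integral basis identify the ring modulo [x] with integer row vectors modulo
    the row lattice of the matrix of multiplication by [x], whose determinant is the norm of [x]. *)
Lemma principal_residues (x : K) : OK x -> x != 0 ->
  finite_set (cosets (principal x)) /\
  forall (C : numClosedFieldType) (s : 'I_n -> {rmorphism K -> C}),
    (exists t, injective (fun i => s i t)) ->
  (idealN (principal x))%:R = `|\prod_i s i x|.
Proof.
move=> Ox x0; have [b [bO bspan bZ]] := integral_basis K.
(* An auxiliary family, used only to see that coordinates are unique and that the determinant is
   nonzero. *)
have [t0 [s0 [s0_inj _]]] := exists_embeddings K algC.
have db0 : \det (embedding_mx s0 b) != 0.
  by apply: span_embedding_mx bspan; exists t0.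
pose B (v : 'rV[int]_n) : K := \sum_j (v 0 j)%:~R * b j.
have BB u v : B (u - v) = B u - B v.
  rewrite /B -sumrB; apply: eq_bigr => j _.
  by rewrite !mxE intrB mulrBl.
have B_inj : injective B.
  move=> u v /eqP; rewrite -subr_eq0 -BB => /eqP B0.
  apply/eqP; rewrite -subr_eq0; apply/eqP; set w := u - v in B0 *.
  have Sw : embedding_mx s0 b *m (map_mx intr w)^T = 0.
    apply/colP => i; rewrite !mxE -[RHS](rmorph0 (s0 i)) -B0 raddf_sum.
    by apply: eq_bigr => j _; rewrite /= rmorphM rmorph_int !mxE mulrC.
  have := congr1 (mulmx (invmx (embedding_mx s0 b))) Sw.
  rewrite mulKmx ?unitmxE ?unitfE // mulmx0 => w0.
  by apply/rowP => j; move/colP/(_ j): w0; rewrite !mxE => /eqP; rewrite intr_eq0 => /eqP.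
have B_surj y : OK y -> exists v, y = B v.
  move=> /bZ[z ->]; exists (\row_j z j).
  by apply: eq_bigr => j _; rewrite mxE.
have BO v : OK (B v).
  by apply: integers_sum => j _; apply: integersM => //; apply: integers_int.
have /choice[z zE] (i : 'I_n) : exists z : 'I_n -> int, x * b i = \sum_j (z j)%:~R * b j.
  by apply: bZ; apply: integersM.
pose A : 'M[int]_n := \matrix_(i, j) z i j.
have BA v : B (v *m A) = x * B v.
  rewrite /B mulr_sumr.
  under [RHS]eq_bigr => i _ do rewrite mulrCA zE mulr_sumr.
  rewrite exchange_big /=; apply: eq_bigr => j _.
  rewrite mxE raddf_sum mulr_suml; apply: eq_bigr => i _.
  by rewrite /= mxE intrM mulrA.
have xbQ i : x * b i = \sum_j (map_mx intr A) i j *: b j.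
  by rewrite zE; apply: eq_bigr => j _; rewrite !mxE scaler_int mulrzl.
have normA (C : numClosedFieldType) (s : 'I_n -> {rmorphism K -> C}) :
    (exists t, injective (fun i => s i t)) -> (\det A)%:~R = \prod_i s i x.
  move=> s_inj; have db := span_embedding_mx s_inj bspan.
  have [<- _] := embedding_norm_trace db xbQ.
  by rewrite det_map_mx /= ratr_int.
have dA : \det A != 0.
  rewrite -(intr_eq0 algC) (normA _ s0); last by exists t0.
  by apply/prodf_neq0 => i _; rewrite fmorph_eq0.
have [T [e [cT eP]]] := lattice_residues dA.
have RS : residue_system (principal x) (B \o e).
  split=> [t|y /B_surj[v ->]] /=; first exact: BO.
  have eqv t : (exists w, v - e t = w *m A) <-> principal x (B v - B (e t)).
    rewrite -BB; split=> [[w ->]|[c /B_surj[w ->]]].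
      by rewrite BA; exists (B w); rewrite // mulrC.
    by rewrite mulrC -BA => /B_inj <-; exists w.
  have [t [/eqv tP tu]] := eP v; exists t; split => // t' /eqv; exact: tu.
have [fin ->] := residue_systemP (principal_submodule x) RS; split=> // C s s_inj.
by rewrite cT -(normA _ _ s_inj) pmulrn abszE intr_norm.
Qed.

End PrincipalIndex.

(** * Ideals *)

Lemma split_lshiftE m n (i : 'I_m) : fintype.split (lshift n i) = inl i.
Proof. exact: (unsplitK (inl i)). Qed.

Lemma split_rshiftE m n (i : 'I_n) : fintype.split (rshift m i) = inr i.
Proof. exact: (unsplitK (inr i)). Qed.

Section IdealArithmetic.
Variable K : fieldExtType rat.
Implicit Types (I J M : set K) (c x y : K).
Local Notation OK := (@integers K).

Lemma submoduleN I x : is_submodule I -> I x -> I (- x).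
Proof. by case=> I0 IB _ Ix; rewrite -sub0r; apply: IB. Qed.

Lemma submoduleD I x y : is_submodule I -> I x -> I y -> I (x + y).
Proof.
move=> subI Ix Iy; rewrite -[y]opprK; have [_ IB _] := subI.
by apply: IB => //; apply: submoduleN.
Qed.

Lemma submodule_sum I (T : Type) (r : seq T) (P : pred T) (F : T -> K) :
  is_submodule I -> (forall i, P i -> I (F i)) -> I (\sum_(i <- r | P i) F i).
Proof.
move=> subI FI; apply: (big_ind I) => //; first by case: subI.
by move=> x y; apply: submoduleD.
Qed.

Lemma integers_submodule : is_submodule OK.
Proof.
split; [exact: integers0|exact: integersB|exact: integersM].
Qed.

Lemma integers_ideal : is_ideal OK.
Proof. by split; first exact: integers_submodule. Qed.

Lemma ideal_mul_in I J x y : I x -> J y -> ideal_mul I J (x * y).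
Proof.
move=> Ix Jy; exists 1%N, (fun=> x), (fun=> y); split => //.
by rewrite big_ord1.
Qed.

Lemma ideal_mul_min I J M : is_submodule M ->
  (forall x y, I x -> J y -> M (x * y)) -> ideal_mul I J `<=` M.
Proof.
move=> subM IJM _ [n [u [v [uv ->]]]]; apply: submodule_sum => // i _.
by case: (uv i); apply: IJM.
Qed.

Lemma ideal_mul_submodule I J : is_submodule I -> is_submodule (ideal_mul I J).
Proof.
move=> subI; have [I0 IB IZ] := subI; split.
- by exists 0%N, (fun=> 0), (fun=> 0); split=> [[]//|]; rewrite big_ord0.
- move=> _ _ [n [u [v [uv ->]]]] [m [u' [v' [uv' ->]]]].
  exists (n + m)%N, (fun i : 'I_(n + m) => match fintype.split i with inl j => u j | inr k => - u' k end),
    (fun i : 'I_(n + m) => match fintype.split i with inl j => v j | inr k => v' k end).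
  split=> [i|].
    by case: (fintype.split i) => j; [apply: uv|case: (uv' j) => ? ?; split=> //; apply: submoduleN].
  rewrite big_split_ord /= -sumrN; congr (_ + _); apply: eq_bigr => i _.
    by rewrite split_lshiftE.
  by rewrite split_rshiftE mulNr.
- move=> c _ Oc [n [u [v [uv ->]]]]; exists n, (fun i => c * u i), v; split.
    by move=> i; have [Iu Jv] := uv i; split=> //; apply: IZ.
  by rewrite mulr_sumr; apply: eq_bigr => i _; rewrite mulrA.
Qed.

Lemma ideal_mulC I J : ideal_mul I J = ideal_mul J I.
Proof.
suffices H : forall A B : set K, ideal_mul A B `<=` ideal_mul B A by apply/seteqP; split; apply: H.
move=> A B _ [n [u [v [uv ->]]]]; exists n, v, u; split=> [i|].
  by have [] := uv i.
by apply: eq_bigr => i _; rewrite mulrC.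
Qed.

Lemma ideal_mulS I I' J J' : I `<=` I' -> J `<=` J' -> ideal_mul I J `<=` ideal_mul I' J'.
Proof.
move=> II JJ _ [n [u [v [uv ->]]]]; exists n, u, v; split=> // i.
by have [/II ? /JJ ?] := uv i.
Qed.

Lemma ideal_mulA I J M : is_submodule I -> is_submodule J -> is_submodule M ->
  ideal_mul I (ideal_mul J M) = ideal_mul (ideal_mul I J) M.
Proof.
have H (A B D : set K) : is_submodule A -> is_submodule B ->
    ideal_mul A (ideal_mul B D) `<=` ideal_mul (ideal_mul A B) D.
  move=> subA subB.
  have [ABD0 ABDB ABDZ] : is_submodule (ideal_mul (ideal_mul A B) D).
    by apply/ideal_mul_submodule/ideal_mul_submodule.
  apply: ideal_mul_min => // x w Ax.
  apply: (ideal_mul_min (M := [set w | ideal_mul (ideal_mul A B) D (x * w)])).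
    split=> [|y z|c y Oc] /=; first by rewrite mulr0.
      by rewrite mulrBr; apply: ABDB.
    by rewrite mulrCA; apply: ABDZ.
  by move=> y z By Dz /=; rewrite mulrA; apply/ideal_mul_in => //; apply: ideal_mul_in.
move=> subI subJ subM; apply/seteqP; split; first exact: H.
(* The reverse inclusion is the same one read from right to left, by commutativity. *)
rewrite [ideal_mul I J]ideal_mulC [X in X `<=` _]ideal_mulC.
by rewrite [ideal_mul J M]ideal_mulC [X in _ `<=` X]ideal_mulC; apply: H.
Qed.

Lemma ideal_mulCA I J M : is_submodule I -> is_submodule J -> is_submodule M ->
  ideal_mul I (ideal_mul J M) = ideal_mul J (ideal_mul I M).
Proof. by move=> *; rewrite !ideal_mulA // [ideal_mul J I]ideal_mulC. Qed.

Lemma principal_mul x I : is_submodule I -> ideal_mul (principal x) I = [set x * y | y in I].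
Proof.
move=> [I0 IB IZ]; apply/seteqP; split.
  apply: ideal_mul_min => [|_ y [c Oc <-] Iy]; last first.
    by exists (c * y); [apply: IZ|rewrite mulrCA mulrA].
  split; first by exists 0; rewrite ?mulr0.
    by move=> _ _ [u Iu <-] [v Iv <-]; exists (u - v); [apply: IB|rewrite mulrBr].
  by move=> c _ Oc [u Iu <-]; exists (c * u); [apply: IZ|rewrite mulrCA].
move=> _ [y Iy <-]; apply: ideal_mul_in => //; exists 1; last by rewrite mul1r.
exact: integers1.
Qed.

Lemma principal_id x : principal x x.
Proof. by exists 1; [apply: integers1|rewrite mul1r]. Qed.

Lemma principal1 : principal 1 = OK.
Proof.
by apply/seteqP; split=> [_ [c Oc <-]|c Oc]; [|exists c]; rewrite ?mulr1.
Qed.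

Lemma principal_sub x I : is_submodule I -> principal x `<=` I <-> I x.
Proof.
move=> [_ _ IZ]; split=> [|Ix _ [c Oc <-]]; last exact: IZ.
by apply; apply: principal_id.
Qed.

Lemma ideal_mul1 I : is_submodule I -> ideal_mul OK I = I.
Proof.
move=> subI; rewrite -principal1 principal_mul //; apply/seteqP.
by split=> [_ [y Iy <-]|y Iy]; [|exists y]; rewrite ?mul1r.
Qed.

Lemma principalM x y : ideal_mul (principal x) (principal y) = principal (x * y).
Proof.
rewrite principal_mul; last exact: principal_submodule.
by apply/seteqP; split=> [_ [_ [c Oc <-] <-]|_ [c Oc <-]];
  [exists c|exists (c * y); [exists c|]]; rewrite // mulrCA.
Qed.

Lemma principal_mulI x I J : x != 0 -> is_submodule I -> is_submodule J ->
  ideal_mul (principal x) I `<=` ideal_mul (principal x) J -> I `<=` J.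
Proof.
move=> x0 subI subJ; rewrite !principal_mul // => IJ y Iy.
by have [|z Jz /(mulfI x0) <-] := IJ (x * y); first by exists y.
Qed.

Definition nonzero_ideal I := is_ideal I /\ is_nonzero I.

Lemma nonzero_ideal_submodule I : nonzero_ideal I -> is_submodule I.
Proof. by case=> [[]]. Qed.

Lemma nonzero_ideal_integers : nonzero_ideal OK.
Proof.
by split; [apply: integers_ideal|exists 1; [apply: integers1|apply: oner_neq0]].
Qed.

Lemma nonzero_ideal_principal x : OK x -> x != 0 -> nonzero_ideal (principal x).
Proof.
move=> Ox x0; split; last by exists x => //; apply: principal_id.
split; first exact: principal_submodule.
by apply/principal_sub => //; apply: integers_submodule.
Qed.

Lemma ideal_mul_subl I J : is_submodule I -> J `<=` OK -> ideal_mul I J `<=` I.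
Proof.
move=> subI JO; apply: ideal_mul_min => // x y Ix /JO Oy.
by rewrite mulrC; case: subI => _ _; apply.
Qed.

Lemma nonzero_ideal_mul I J : nonzero_ideal I -> nonzero_ideal J ->
  nonzero_ideal (ideal_mul I J).
Proof.
move=> [[subI IO] [x Ix x0]] [[subJ JO] [y Jy y0]]; split; last first.
  by exists (x * y); [apply: ideal_mul_in|apply: mulf_neq0].
split; first exact: ideal_mul_submodule.
exact: subset_trans (ideal_mul_subl subI JO) IO.
Qed.

Lemma nonzero_ideal_exp I k : nonzero_ideal I -> nonzero_ideal (ideal_exp I k).
Proof.
move=> nzI; elim: k => [|k IH]; first exact: nonzero_ideal_integers.
exact: nonzero_ideal_mul.
Qed.

Lemma ideal_exp_sub I k : nonzero_ideal I -> ideal_exp I k `<=` OK.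
Proof. by move=> /(nonzero_ideal_exp k)[[]]. Qed.

Lemma ideal_expD I j k : nonzero_ideal I ->
  ideal_exp I (j + k) = ideal_mul (ideal_exp I j) (ideal_exp I k).
Proof.
move=> nzI; have subE m := nonzero_ideal_submodule (nonzero_ideal_exp m nzI).
elim: j => [|j IH]; first by rewrite ideal_mul1.
by rewrite addSn /= IH ideal_mulA //; apply: nonzero_ideal_submodule.
Qed.

Lemma finite_cosets_ideal I : nonzero_ideal I -> finite_set (cosets I).
Proof.
case=> [[subI IO] [x Ix x0]].
have [fin _] := principal_residues (IO _ Ix) x0.
by apply: finite_cosetsS fin => //; [apply: principal_submodule|apply/principal_sub].
Qed.

(** [I] contains some (a) of finite index. The generators are a times an integral basis, and those
    representatives modulo (a) that lie in [I], the others being replaced by 0. *)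
Lemma ideal_generators I : nonzero_ideal I -> exists n (m : 'I_n -> K),
  [/\ forall i, I (m i), exists i, m i != 0 &
      forall x, I x -> exists z : 'I_n -> int, x = \sum_i (z i)%:~R * m i].
Proof.
move=> nzI; have [[subI IO] [a Ia a0]] := nzI; have [I0 IB IZ] := subI.
have [b [bO _ bZ]] := integral_basis K.
have nza := nonzero_ideal_principal (IO _ Ia) a0.
have [e [eO e_uniq]] := exists_residue_system (nonzero_ideal_submodule nza) (finite_cosets_ideal nza).
pose m (i : 'I_(\dim {:K} + idealN (principal a))) := match fintype.split i with
  | inl j => a * b j | inr t => if `[< I (e t) >] then e t else 0 end.
have mI i : I (m i).
  rewrite /m; case: (fintype.split i) => [j|t]; first by rewrite mulrC; apply: IZ.
  by case: asboolP.
have mspan x : I x -> exists z : 'I__ -> int, x = \sum_i (z i)%:~R * m i.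
  move=> Ix; have [t [[c Oc cE] _]] := e_uniq x (IO _ Ix).
  have [z zE] := bZ c Oc.
  have Iet : I (e t).
    have -> : e t = x - c * a by rewrite cE; ring.
    by apply: IB => //; apply: IZ.
  exists (fun i => match fintype.split i with inl j => z j | inr u => (u == t)%:Z end).
  have xE : x = c * a + e t by rewrite cE subrK.
  rewrite {1}xE big_split_ord /=; congr (_ + _).
    rewrite zE mulr_suml; apply: eq_bigr => j _.
    by rewrite /m !split_lshiftE -mulrA [b j * a]mulrC.
  rewrite (bigD1 t) //= big1 ?addr0 => [|u ut].
    by rewrite /m !split_rshiftE eqxx mul1r; case: asboolP.
  by rewrite split_rshiftE (negbTE ut) mul0r.
exists _, m; split=> //; apply: contrapT => m0; move: a0.
have [z ->] := mspan a Ia; rewrite big1 ?eqxx // => i _.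
have [->|mi] := eqVneq (m i) 0; first by rewrite mulr0.
by case: m0; exists i.
Qed.


End IdealArithmetic.

(** * Integral closure, Nakayama's lemma and invertibility of ideals *)

Section Invertibility.
Variable K : fieldExtType rat.
Implicit Types (I J M B : set K) (c x y : K).
Local Notation OK := (@integers K).

(** [y] acts by an integer matrix on finitely many additive generators of [M]. *)
Lemma stable_ideal_integral M y :
  nonzero_ideal M -> (forall x, M x -> M (y * x)) -> OK y.
Proof.
move=> nzM yM; have [n [m [mM m0 mspan]]] := ideal_generators nzM.
have /choice[z zE] i := mspan _ (yM _ (mM i)).
apply: (@integral_of_stable_span _ _ m (\matrix_(i, j) z i j) y m0) => i.
by rewrite zE; apply: eq_bigr => j _; rewrite mxE.
Qed.

(** Modulo [B] the identity permutation contributes 1 to the determinant; any other permutation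
    picks an off-diagonal entry, which lies in [B]. *)
Lemma det_unipotent_mod B n (A : 'M[K]_n) : is_ideal B ->
  (forall i j, B (A i j)) -> B (1 - \det (1%:M - A)).
Proof.
move=> idB AB; have [subB BO] := idB; have [B0 BB BZ] := subB.
pose U : 'M[K]_n := 1%:M - A.
have UO i j : OK (U i j).
  rewrite !mxE; apply: integersB; first exact: integers_nat.
  by apply/BO/AB.
rewrite -/U /determinant (bigD1 (1%g : 'S_n)) //= odd_perm1 expr0 mul1r opprD addrA.
apply: (BB).
  have /(_ (index_enum 'I_n)) : forall r : seq 'I_n,
      B (1 - \prod_(i <- r) U i ((1%g : 'S_n) i)).
    elim=> [|i r IH]; first by rewrite big_nil subrr.
    rewrite big_cons perm1 !mxE eqxx.
    set P := \prod_(j <- r) _ in IH *.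
    have -> : 1 - (1 - A i i) * P = (1 - P) - - (P * A i i) by ring.
    apply: BB => //; apply: submoduleN => //; apply: BZ => //.
    by apply: integers_prod.
  by [].
apply: submodule_sum => // p p1.
have [i pi] : exists i, p i != i.
  apply: contrapT => np; move: p1; rewrite (_ : p = 1%g) ?eqxx //.
  apply/permP => i; rewrite perm1; apply: contrapT => /eqP pi.
  by apply: np; exists i.
apply: (BZ); first by apply: integersX; apply: integersN; apply: integers1.
rewrite (bigD1 i) //= mulrC; apply: BZ; first exact: integers_prod.
by rewrite !mxE eq_sym (negbTE pi) sub0r; apply: submoduleN.
Qed.

(** The generators of [M] satisfy m = A m with entries of A in [B]. Since they are not all zero,
    det(1 - A) vanishes in the field, while it is 1 modulo [B]. *)
Lemma nakayama B M : is_ideal B -> nonzero_ideal M -> M `<=` ideal_mul B M -> B 1.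
Proof.
move=> idB nzM MBM; have [subB BO] := idB; have [B0 BB BZ] := subB.
have [n [m [mM [i0 mi0] mspan]]] := ideal_generators nzM.
have BMspan : ideal_mul B M `<=`
    [set x | exists q : 'I_n -> K, (forall i, B (q i)) /\ x = \sum_i q i * m i].
  apply: ideal_mul_min.
    split.
    - by exists (fun=> 0); split=> //; rewrite big1 // => i _; rewrite mul0r.
    - move=> _ _ [p [pB ->]] [q [qB ->]]; exists (fun i => p i - q i).
      split=> [i|]; first exact: BB.
      by rewrite -sumrB; apply: eq_bigr => i _; rewrite mulrBl.
    - move=> c _ Oc [q [qB ->]]; exists (fun i => c * q i).
      split=> [i|]; first exact: BZ.
      by rewrite mulr_sumr; apply: eq_bigr => i _; rewrite mulrA.
  move=> x y Bx /mspan[z ->]; exists (fun i => (z i)%:~R * x); split=> [i|].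
    by apply: BZ => //; apply: integers_int.
  by rewrite mulr_sumr; apply: eq_bigr => i _; rewrite mulrCA mulrA.
have /choice[q qP] i := BMspan _ (MBM _ (mM i)).
pose A := \matrix_(i, j) q i j.
have : B (1 - \det (1%:M - A)).
  by apply: det_unipotent_mod => // i j; rewrite mxE; case: (qP i).
suffices -> : \det (1%:M - A) = 0 by rewrite subr0.
apply/eqP/negPn/negP => dA.
have mA : (1%:M - A) *m (\col_i m i) = 0.
  rewrite mulmxBl mul1mx; apply/colP => i; rewrite !mxE {1}(qP i).2.
  by rewrite -sumrB big1 // => j _; rewrite !mxE subrr.
have := congr1 (mulmx (invmx (1%:M - A))) mA.
rewrite mulKmx ?unitmxE ?unitfE // mulmx0 => /colP/(_ i0).
by rewrite !mxE => /eqP; rewrite (negbTE mi0).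
Qed.

Section FiniteClassNumber.
Variables (h : nat) (a : 'I_h -> set K).
Hypothesis ha : class_representatives a.

Lemma fractional_nonzero_ideal I : nonzero_ideal I -> is_fractional_ideal I.
Proof.
move=> [[subI IO] nzI]; split=> //; exists 1; split; first exact: integers1.
  exact: oner_neq0.
by move=> x /IO; rewrite mul1r.
Qed.

(* Two of the powers of I lie in the same class, say I^j = d I^i with i < j;
   then I^(j-i) I^i = d I^i forces I^(j-i) = d O_K. *)
Lemma ideal_invertible I : nonzero_ideal I -> exists J c,
  [/\ nonzero_ideal J, c != 0 & ideal_mul I J = principal c].
Proof.
move=> nzI; have nzE k := nonzero_ideal_exp k nzI.
have subE k := nonzero_ideal_submodule (nzE k).
have /choice[l lP] k : exists l, same_class (a l) (ideal_exp I k).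
  have [_ /(_ _ (fractional_nonzero_ideal (nzE k)))[l [? _]]] := ha.
  by exists l.
(* Pigeonhole: the h + 1 exponents 0, ..., h meet only h classes. *)
have : ~ injective (fun k : 'I_h.+1 => l k).
  by move/leq_card; rewrite !card_ord ltnn.
move=> l_ninj; have [i [k [ltik lik]]] : exists i k, (i < k)%N /\ l i = l k.
  apply: contrapT => nik; apply: l_ninj => u v luv; apply/val_inj.
  by case: (ltngtP u v) => // lt; case: nik; [exists u, v|exists v, u].
have [d d0 dE] : exists2 d, d != 0 &
    ideal_exp I k = [set d * x | x in ideal_exp I i].
  have [c c0 cE] := lP i; have [c' c'0 c'E] := lP k.
  exists (c' / c); first by rewrite mulf_neq0 ?invr_eq0.
  rewrite cE c'E lik; apply/seteqP; split=> [_ [x ax <-]|_ [_ [x ax <-] <-]].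
    by exists (c * x); [exists x|rewrite mulrA divfK].
  by exists x; rewrite // mulrA divfK.
pose E := ideal_exp I (k - i).
have EE : ideal_mul E (ideal_exp I i) = [set d * x | x in ideal_exp I i].
  by rewrite -ideal_expD // subnK // ltnW.
(* [y / d] stabilizes I^i, because y I^i is contained in E I^i = d I^i. *)
have E_d y : E y -> OK (y / d).
  move=> Ey; apply: (stable_ideal_integral (nzE i)) => x Ex.
  have : ideal_mul E (ideal_exp I i) (y * x) by apply: ideal_mul_in.
  by rewrite EE => -[w Ew wE]; rewrite mulrAC -wE mulrAC mulfV // mul1r.
have [E0 EB EZ] := subE (k - i)%N.
(* The previous step makes d^-1 E an integral ideal; its product with I^i is I^i, so by Nakayama it
   contains 1, that is, [d] lies in [E]. *)
have E1 : [set y | E (d * y)] 1.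
  apply: (nakayama _ (nzE i)).
    split; last by move=> y /E_d; rewrite mulrAC mulfV // mul1r.
    split=> [|x y|c x Oc] /=; first by rewrite mulr0.
      by rewrite mulrBr; apply: EB.
    by rewrite mulrCA; apply: EZ.
  move=> x Ex; have : [set d * x | x in ideal_exp I i] (d * x) by exists x.
  rewrite -EE => -[n [u [v [uv dxE]]]].
  exists n, (fun i => u i / d), v; split=> [j|].
    by have [Eu Iv] := uv j; split => //=; rewrite mulrCA mulfV // mulr1.
  apply: (mulfI d0); rewrite dxE mulr_sumr; apply: eq_bigr => j _.
  by rewrite mulrA mulrCA mulfV // mulr1.
exists (ideal_exp I (k - i).-1), d; split=> //.
rewrite -[ideal_mul _ _]/(ideal_exp I (k - i).-1.+1) prednK ?subn_gt0 //.
apply/seteqP; split=> [y Ey|]; first by exists (y / d); [apply: E_d|rewrite divfK].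
by apply/principal_sub; [apply: subE|rewrite -[d]mulr1].
Qed.

(** Multiplying by an ideal that makes [I] principal reduces cancellation to division by a nonzero
    element. *)
Lemma ideal_mulI I J M : nonzero_ideal I -> is_submodule J -> is_submodule M ->
  ideal_mul I J `<=` ideal_mul I M -> J `<=` M.
Proof.
move=> nzI subJ subM IJM; have [V [c [nzV c0 IV]]] := ideal_invertible nzI.
have [subI subV] := (nonzero_ideal_submodule nzI, nonzero_ideal_submodule nzV).
apply: (principal_mulI c0) => //.
rewrite -IV [ideal_mul I V]ideal_mulC -!ideal_mulA //.
exact: ideal_mulS.
Qed.

(** If J V = (c), the quotient is M = c^-1 V I, which is integral because V I is contained in V J =
    (c). *)
Lemma ideal_divides I J : nonzero_ideal I -> nonzero_ideal J -> I `<=` J ->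
  exists2 M, nonzero_ideal M & I = ideal_mul J M.
Proof.
move=> nzI nzJ IJ; have [V [c [nzV c0 JV]]] := ideal_invertible nzJ.
have [subI subV] := (nonzero_ideal_submodule nzI, nonzero_ideal_submodule nzV).
have subJ := nonzero_ideal_submodule nzJ.
have nzVI := nonzero_ideal_mul nzV nzI.
have [[[VI0 VIB VIZ] VIO] [x0 VIx x00]] := nzVI.
have VIc : ideal_mul V I `<=` principal c.
  by rewrite -JV [ideal_mul J V]ideal_mulC; apply: ideal_mulS.
pose M := [set x | ideal_mul V I (c * x)].
have subM : is_submodule M.
  split=> [|x y|d x Od]; rewrite /M /=; first by rewrite mulr0.
    by rewrite mulrBr; apply: VIB.
  by rewrite mulrCA; apply: VIZ.
have VIM : ideal_mul V I = ideal_mul (principal c) M.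
  rewrite principal_mul //; apply/seteqP; split=> [x VIx'|_ [x Mx <-] //].
  have [d Od dE] := VIc x VIx'; exists d; last by rewrite mulrC.
  by rewrite /M /= mulrC dE.
have nzM : nonzero_ideal M.
  split; last first.
    have [d Od dE] := VIc x0 VIx; exists d; first by rewrite /M /= mulrC dE.
    by apply: contraNneq x00 => d0; rewrite -dE d0 mul0r.
  split=> // x /VIc[d Od]; rewrite mulrC => /(mulfI c0) <-.
  by [].
exists M => //.
have subJM : is_submodule (ideal_mul J M) by apply: ideal_mul_submodule.
suffices E : ideal_mul (principal c) I = ideal_mul (principal c) (ideal_mul J M).
  by apply/seteqP; split; apply: (principal_mulI c0); rewrite // E.
have subc := principal_submodule c.
by rewrite [RHS]ideal_mulCA // -VIM ideal_mulA // JV.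
Qed.

End FiniteClassNumber.
End Invertibility.

(** * Factorization of ideals *)

Section Factorization.
Variable K : fieldExtType rat.
Implicit Types (I J M P Q : set K) (c x y : K).
Local Notation OK := (@integers K).

Lemma ideal_eq_integers I : is_ideal I -> I 1 -> I = OK.
Proof.
move=> [[_ _ IZ] IO] I1; apply/seteqP; split=> // x Ox.
by rewrite -[x]mulr1; apply: IZ.
Qed.

Lemma natr_eq0_numfield n : (n%:R == 0 :> K) = (n == 0)%N.
Proof. by rewrite -(rmorph_nat (in_alg K)) fmorph_eq0 pnatr_eq0. Qed.

Lemma idealN_integers : idealN OK = 1%N.
Proof.
have [t [s [s_inj _]]] := exists_embeddings K algC.
have [_ /(_ _ s)] := principal_residues (integers1 K) (oner_neq0 K).
rewrite principal1 big1 => [NE|i _]; last exact: rmorph1.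
apply/eqP; rewrite -(eqr_nat algC) NE ?normr1 //.
by exists t.
Qed.

Lemma idealN_gt0 I : nonzero_ideal I -> (0 < idealN I)%N.
Proof.
move=> nzI; have [[subI IO] _] := nzI; rewrite -idealN_integers.
by have [] := idealNS subI (integers_submodule K) IO (finite_cosets_ideal nzI).
Qed.

Lemma maximal_proper P : is_maximal_ideal P -> ~ P 1.
Proof. by case=> idP P1 _ /(ideal_eq_integers idP). Qed.

(** If the zero ideal were maximal, (2) would be the whole ring, but its norm is 2 to the power
    [\dim {:K}], which exceeds 1. *)
Lemma maximal_nonzero P : is_maximal_ideal P -> nonzero_ideal P.
Proof.
move=> maxP; have [idP PO Pmax] := maxP; split=> //; apply: contrapT => zP.
have two0 : 2 != 0 :> K by rewrite natr_eq0_numfield.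
have O2 : OK 2 := integers_nat K 2.
have [[idp subp] _] := nonzero_ideal_principal O2 two0.
have [||E|E] := Pmax (principal 2) => //.
- move=> x Px; have [->|x0] := eqVneq x 0; first by case: idp.
  by case: zP; exists x.
- by apply: zP; exists 2; rewrite // -E; apply: principal_id.
have [t [s [s_inj _]]] := exists_embeddings K algC.
have [_ /(_ _ s)] := principal_residues O2 two0.
rewrite E idealN_integers (eq_bigr (fun=> 2)) => [|i _]; last exact: rmorph_nat.
rewrite prodr_const card_ord normrX normr_nat -natrX => /(_ (ex_intro _ t s_inj)).
move/eqP; rewrite eqr_nat eq_sym -(expn0 2) eqn_exp2l // => /eqP n0.
have : (0 < \dim {:K})%N by rewrite adim_gt0.
by rewrite n0.
Qed.

Lemma maximal_inverse P x : is_maximal_ideal P -> OK x -> ~ P x ->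
  exists2 c, OK c & P (1 - x * c).
Proof.
move=> maxP Ox nPx; have [[[P0 PB PZ] PO] _ Pmax] := maxP.
pose J := [set y | OK y /\ exists2 c, OK c & P (y - x * c)].
have idJ : is_ideal J.
  split; last by move=> y [].
  split.
  - split; first exact: integers0.
    by exists 0; [apply: integers0|rewrite mulr0 subrr].
  - move=> y z [Oy [c Oc yc]] [Oz [d Od zd]]; split; first exact: integersB.
    exists (c - d); first exact: integersB.
    have -> : y - z - x * (c - d) = (y - x * c) - (z - x * d) by ring.
    exact: PB.
  - move=> c y Oc [Oy [d Od yd]]; split; first exact: integersM.
    exists (c * d); first exact: integersM.
    have -> : c * y - x * (c * d) = c * (y - x * d) by ring.
    exact: PZ.
have PJ : P `<=` J.
  move=> y Py; split; first exact: PO.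
  by exists 0; [apply: integers0|rewrite mulr0 subr0].
have [JP|JO] := Pmax J idJ PJ.
  case: nPx; rewrite -JP; split=> //.
  by exists 1; [apply: integers1|rewrite mulr1 subrr].
have [_ [c Oc xc]] : J 1 by rewrite JO; apply: integers1.
by exists c.
Qed.

(** An inverse modulo P^k is lifted by multiplying the error 1 - x c by an error 1 - x d in [P]; the
    product again has the form 1 - x c'. *)
Lemma maximal_inverse_exp P x k : is_maximal_ideal P -> OK x -> ~ P x ->
  exists2 c, OK c & ideal_exp P k (1 - x * c).
Proof.
move=> maxP Ox nPx; elim: k => [|k [c Oc xc]].
  by exists 0; [apply: integers0|rewrite mulr0 subr0; apply: integers1].
have [d Od xd] := maximal_inverse maxP Ox nPx.
exists (c + d - x * c * d).
  apply: integersB; first exact: integersD.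
  by apply: integersM => //; apply: integersM.
have -> : 1 - x * (c + d - x * c * d) = (1 - x * d) * (1 - x * c) by ring.
exact: ideal_mul_in.
Qed.

Lemma maximal_exp_primary P x y k : is_maximal_ideal P -> OK x -> ~ P x -> OK y ->
  ideal_exp P k (x * y) -> ideal_exp P k y.
Proof.
move=> maxP Ox nPx Oy Pxy; have [c Oc xc] := maximal_inverse_exp k maxP Ox nPx.
have [[subE _] _] := nonzero_ideal_exp k (maximal_nonzero maxP).
have [_ _ EZ] := subE.
have -> : y = c * (x * y) + y * (1 - x * c) by ring.
by apply: submoduleD => //; apply: EZ.
Qed.

(** Let [J] be a proper ideal of least norm above [I]. A proper ideal above [J] has at least the
    norm of [J], so [idealNS] makes them equal. *)
Lemma exists_maximal I : nonzero_ideal I -> ~ I 1 ->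
  exists2 P, is_maximal_ideal P & I `<=` P.
Proof.
move=> nzI nI1; have [_ [i0 Ii0 i00]] := nzI.
pose good J := [/\ nonzero_ideal J, I `<=` J & ~ J 1].
have exN : exists N, `[< exists2 J, good J & idealN J = N >].
  by exists (idealN I); apply/asboolP; exists I => //; split.
case: (ex_minnP exN) => N /asboolP[J [nzJ IJ nJ1] NJ] Nmin.
exists J => //; split; [by case: nzJ|by move=> JO; apply/nJ1; rewrite JO; apply: integers1|].
move=> M idM JM; have [M1|nM1] := EM (M 1).
  by right; apply: ideal_eq_integers.
left; apply/seteqP; split=> //.
have nzM : nonzero_ideal M by split=> //; exists i0 => //; apply/JM/IJ.
have [subJ subM] := (nonzero_ideal_submodule nzJ, nonzero_ideal_submodule nzM).
have [_] := idealNS subJ subM JM (finite_cosets_ideal nzJ); apply.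
  by case: idM.
rewrite NJ; apply: Nmin; apply/asboolP; exists M => //; split=> //.
exact: subset_trans JM.
Qed.

Lemma maximal_idealN_gt1 P : is_maximal_ideal P -> (1 < idealN P)%N.
Proof.
move=> maxP; have nzP := maximal_nonzero maxP; have [[subP PO] _] := nzP.
have [_ H] := idealNS subP (integers_submodule K) PO (finite_cosets_ideal nzP).
rewrite ltnNge -idealN_integers; apply/negP => /(H (fun _ => id)) OP.
by apply: (maximal_proper maxP); apply: OP; apply: integers1.
Qed.

Definition ideal_prod (s : seq (set K)) := foldr (@ideal_mul K) OK s.

Definition maximal_seq (s : seq (set K)) := forall P, P \in s -> is_maximal_ideal P.

Lemma maximal_seq_cat s t : maximal_seq s -> maximal_seq t -> maximal_seq (s ++ t).
Proof. by move=> maxs maxt P; rewrite mem_cat => /orP[/maxs|/maxt]. Qed.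

Lemma maximal_seq_cons P s : maximal_seq (P :: s) -> is_maximal_ideal P /\ maximal_seq s.
Proof.
move=> maxs; split=> [|Q Qs]; apply: maxs; first exact: mem_head.
by rewrite inE Qs orbT.
Qed.

Lemma nonzero_ideal_prod s : maximal_seq s -> nonzero_ideal (ideal_prod s).
Proof.
elim: s => [_|P s IH /maximal_seq_cons[maxP maxs]]; first exact: nonzero_ideal_integers.
by apply: nonzero_ideal_mul; [apply: maximal_nonzero|apply: IH].
Qed.

Lemma ideal_prod_cat s t : maximal_seq s -> maximal_seq t ->
  ideal_prod (s ++ t) = ideal_mul (ideal_prod s) (ideal_prod t).
Proof.
move=> maxs maxt; have subt := nonzero_ideal_submodule (nonzero_ideal_prod maxt).
elim: s maxs => [_|P s IH /maximal_seq_cons[maxP maxs']]; first by rewrite ideal_mul1.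
have nzP := maximal_nonzero maxP.
rewrite /= IH // ideal_mulA //; first exact: nonzero_ideal_submodule nzP.
exact: nonzero_ideal_submodule (nonzero_ideal_prod maxs').
Qed.

Section FiniteClassNumber.
Variables (h : nat) (a : 'I_h -> set K).
Hypothesis ha : class_representatives a.

(** J / PJ is a line over the residue field of [P]. By Nakayama some [y] in [J] is outside PJ; the
    ideal M generated by [y] and PJ equals J L with L containing [P], and L = [P] is excluded by
    [y], so M = [J]. *)
Lemma idealN_maximal_mul P J : is_maximal_ideal P -> nonzero_ideal J ->
  idealN (ideal_mul P J) = (idealN P * idealN J)%N.
Proof.
move=> maxP nzJ; have [_ _ Pmax] := maxP; have nzP := maximal_nonzero maxP.
have [[subP PO] _] := nzP; have [[subJ JO] _] := nzJ; have [J0 JB JZ] := subJ.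
have nzPJ := nonzero_ideal_mul nzP nzJ; have subPJ := nonzero_ideal_submodule nzPJ.
have [PJ0 PJB PJZ] := subPJ.
have PJJ : ideal_mul P J `<=` J by rewrite ideal_mulC; apply: ideal_mul_subl.
have [y Jy nPJy] : exists2 y, J y & ~ ideal_mul P J y.
  apply: contrapT => nJ; apply: (maximal_proper maxP).
  apply: (nakayama (M := J)) => //.
  by move=> y Jy; apply: contrapT => ny; apply: nJ; exists y.
have PyE z : OK z -> ideal_mul P J (y * z) -> P z.
  move=> Oz PJyz; apply: contrapT => nPz; apply: nPJy.
  have [c Oc zc] := maximal_inverse maxP Oz nPz.
  have -> : y = c * (y * z) + (1 - z * c) * y by ring.
  apply: submoduleD => //; first exact: PJZ.
  exact: ideal_mul_in.
have Jgen w : J w -> exists2 c, OK c & ideal_mul P J (w - y * c).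
  pose M := [set w | J w /\ exists2 c, OK c & ideal_mul P J (w - y * c)].
  have MJ : M `<=` J by move=> ? [].
  have PJM : ideal_mul P J `<=` M.
    move=> v PJv; split; first exact: PJJ.
    by exists 0; [apply: integers0|rewrite mulr0 subr0].
  have My : M y by split=> //; exists 1; [apply: integers1|rewrite mulr1 subrr].
  have subM : is_submodule M.
    split.
    - by split=> //; exists 0; [apply: integers0|rewrite mulr0 subrr].
    - move=> u v [Ju [c Oc uc]] [Jv [d Od vd]]; split; first exact: JB.
      exists (c - d); first exact: integersB.
      have -> : u - v - y * (c - d) = (u - y * c) - (v - y * d) by ring.
      exact: PJB.
    - move=> c u Oc [Ju [d Od ud]]; split; first exact: JZ.
      exists (c * d); first exact: integersM.
      have -> : c * u - y * (c * d) = c * (u - y * d) by ring.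
      exact: PJZ.
  have nzM : nonzero_ideal M.
    have [_ [w0 PJw0 w00]] := nzPJ.
    by split; [split=> // v /MJ /JO|exists w0 => //; apply: PJM].
  have [L nzL ME] := ideal_divides ha nzM nzJ MJ.
  have [subL LO] : is_ideal L by case: nzL.
  have PL : P `<=` L.
    by apply: (ideal_mulI ha nzJ) => //; rewrite -ME ideal_mulC.
  have [LP|LE] := Pmax L (conj subL LO) PL.
    by case: nPJy; rewrite ideal_mulC -LP -ME.
  by move=> Jw; have [] : M w by rewrite ME LE ideal_mulC ideal_mul1.
have [e [eO e_uniq]] := exists_residue_system subJ (finite_cosets_ideal nzJ).
have [f [fO f_uniq]] := exists_residue_system subP (finite_cosets_ideal nzP).
(* Multiplication by [y] identifies residues modulo [P] with residues of [J] modulo PJ. *)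
suffices RS : residue_system (ideal_mul P J) (fun ut => e ut.2 + y * f ut.1).
  by have [_ ->] := residue_systemP subPJ RS; rewrite card_prod !card_ord.
split=> [[u t] /=|x Ox].
  by apply: integersD => //; apply: integersM => //; apply: JO.
have [t [Jt tu]] := e_uniq x Ox; have [c Oc cE] := Jgen _ Jt.
have [u [Pu uu]] := f_uniq c Oc; exists (u, t); split=> [|[u' t'] /= xE].
  have -> : x - (e t + y * f u) = (x - e t - y * c) + (c - f u) * y by ring.
  by apply: submoduleD => //; apply: ideal_mul_in.
have tt' : t = t'.
  apply: tu; have -> : x - e t' = x - (e t' + y * f u') + f u' * y by ring.
  by apply: submoduleD => //; [apply: PJJ|apply: JZ].
rewrite -tt' in xE *; congr (_, _); apply: uu; apply: PyE; first exact: integersB.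
have -> : y * (c - f u') = (x - (e t + y * f u')) - (x - e t - y * c) by ring.
exact: PJB.
Qed.

Lemma idealN_prod s : maximal_seq s ->
  idealN (ideal_prod s) = (\prod_(P <- s) idealN P)%N.
Proof.
elim: s => [_|P s IH /maximal_seq_cons[maxP maxs]]; first by rewrite big_nil idealN_integers.
by rewrite big_cons /= idealN_maximal_mul ?IH //; apply: nonzero_ideal_prod.
Qed.

Lemma exists_factorization I : nonzero_ideal I ->
  exists2 s, maximal_seq s & I = ideal_prod s.
Proof.
have [n] := ubnP (idealN I); elim: n I => // n IH I ltIn nzI.
have [I1|nI1] := EM (I 1).
  by exists [::] => //; apply: ideal_eq_integers => //; case: nzI.
have [P maxP IP] := exists_maximal nzI nI1.
have nzP := maximal_nonzero maxP.
have [J nzJ IE] := ideal_divides ha nzI nzP IP.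
have [|s maxs JE] := IH J _ nzJ.
  apply: leq_trans (ltIn : (idealN I <= n)%N).
  by rewrite IE idealN_maximal_mul // ltn_Pmull ?maximal_idealN_gt1 ?idealN_gt0.
exists (P :: s); last by rewrite IE JE.
by move=> Q; rewrite inE => /orP[/eqP ->|/maxs].
Qed.

Lemma idealNM I J : nonzero_ideal I -> nonzero_ideal J ->
  idealN (ideal_mul I J) = (idealN I * idealN J)%N.
Proof.
move=> /exists_factorization[s maxs ->] /exists_factorization[t maxt ->].
rewrite -ideal_prod_cat // !idealN_prod // ?big_cat //.
exact: maximal_seq_cat.
Qed.

Lemma maximal_sub P Q : is_maximal_ideal P -> is_maximal_ideal Q -> P `<=` Q -> P = Q.
Proof.
move=> [_ _ Pmax] maxQ PQ; have [idQ QO _] := maxQ.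
by have [->|/QO] := Pmax Q idQ PQ.
Qed.

(** A factor equal to [Q] is cancelled on both sides; another factor contains an element outside
    [Q], which is invertible modulo Q^k. This gives uniqueness of factorization and ties
    multiplicities to the exact powers in [is_valuation]. *)
Lemma ideal_prod_sub_exp s Q k : maximal_seq s -> is_maximal_ideal Q ->
  ideal_prod s `<=` ideal_exp Q k <-> (k <= count_mem Q s)%N.
Proof.
move=> maxs maxQ; have nzQ := maximal_nonzero maxQ.
have subE j := nonzero_ideal_submodule (nonzero_ideal_exp j nzQ).
elim: s k maxs => [|P s IH] k maxs /=.
  case: k => [|k]; first by split=> // _ x.
  split=> // OQ; exfalso; apply: (maximal_proper maxQ).
  have := ideal_mul_subl (nonzero_ideal_submodule nzQ) (ideal_exp_sub (k := k) nzQ).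
  by apply; apply: OQ; apply: integers1.
have [maxP maxs'] := maximal_seq_cons maxs.
have nzP := maximal_nonzero maxP; have nzs := nonzero_ideal_prod maxs'.
have [subs sO] : is_ideal (ideal_prod s) by case: nzs.
case: eqP => [->|PQ].
  case: k => [|k]; first by split=> // _; case: (nonzero_ideal_mul nzQ nzs) => -[].
  rewrite add1n ltnS -IH //; split=> [|sub]; last exact: ideal_mulS.
  exact: (ideal_mulI ha nzQ subs (subE k)).
rewrite add0n -IH //; split=> [sub y sy|sub].
  have [x Px nQx] : exists2 x, P x & ~ Q x.
    apply: contrapT => nPQ; apply: PQ; apply: maximal_sub => // x Px.
    by apply: contrapT => nQx; apply: nPQ; exists x.
  have Ox : OK x by case: nzP => [[_ PO] _]; apply: PO.
  apply: (maximal_exp_primary maxQ Ox nQx (sO _ sy)).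
  by apply: sub; apply: ideal_mul_in.
apply: subset_trans sub; rewrite ideal_mulC; apply: ideal_mul_subl => //.
by case: nzP => -[].
Qed.

Lemma eq_count_ideal_prod s t Q : maximal_seq s -> maximal_seq t ->
  is_maximal_ideal Q -> ideal_prod s = ideal_prod t -> count_mem Q s = count_mem Q t.
Proof.
move=> maxs maxt maxQ E; apply/eqP; rewrite eqn_leq; apply/andP; split.
  by rewrite -ideal_prod_sub_exp // -E ideal_prod_sub_exp.
by rewrite -ideal_prod_sub_exp // E ideal_prod_sub_exp.
Qed.

End FiniteClassNumber.
End Factorization.

(** * Finite places *)

Section FinitePlaces.
Variable K : fieldExtType rat.
Implicit Types (I J P Q : set K) (c x y : K).
Local Notation OK := (@integers K).

Lemma maximal_prime P x y : is_maximal_ideal P -> OK x -> OK y ->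
  P (x * y) -> P x \/ P y.
Proof.
move=> maxP Ox Oy Pxy; have [Px|nPx] := EM (P x); [by left|right].
have [c Oc xc] := maximal_inverse maxP Ox nPx.
have [[subP _] _] := maximal_nonzero maxP; have [_ _ PZ] := subP.
have -> : y = c * (x * y) + y * (1 - x * c) by ring.
by apply: submoduleD => //; apply: PZ.
Qed.

(** Two of the integers 0, ..., N(P) agree modulo [P], so [P] contains a positive integer. Let [m]
    be the least one: m / pdiv m is smaller, hence outside [P], and primality of [P] puts [pdiv m]
    inside. *)
Lemma residue_charP P : is_maximal_ideal P ->
  prime (residue_char P) /\ P (residue_char P)%:R.
Proof.
move=> maxP; apply: (@xgetPex _ 0%N [set p | prime p /\ P p%:R]).
have nzP := maximal_nonzero maxP; have [[subP _] _] := nzP; have [P0 PB _] := subP.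
have [e [_ e_uniq]] := exists_residue_system subP (finite_cosets_ideal nzP).
have /choice[f fP] k : exists t, P (k%:R - e t).
  by have [t [Pt _]] := e_uniq k%:R (integers_nat K k); exists t.
have f_ninj : ~ injective (fun k : 'I_(idealN P).+1 => f k).
  by move/leq_card; rewrite !card_ord ltnn.
have exm : exists m, (0 < m)%N && `[< P m%:R >].
  apply: contrapT => nm; apply: f_ninj => u v fuv; apply/val_inj.
  have Pd i j : f i = f j -> P (j%:R - i%:R).
    move=> fij; have -> : j%:R - i%:R = (j%:R - e (f j)) - (i%:R - e (f i)) :> K.
      by rewrite fij; ring.
    exact: PB.
  case: (ltngtP u v) => // lt; case: nm.
    exists (v - u)%N; rewrite subn_gt0 lt; apply/asboolP.
    by rewrite natrB ?(ltnW lt) //; apply: Pd.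
  exists (u - v)%N; rewrite subn_gt0 lt; apply/asboolP.
  by rewrite natrB ?(ltnW lt) //; apply: Pd.
case: (ex_minnP exm) => m /andP[m0 /asboolP Pm] m_min.
have m1 : (1 < m)%N.
  rewrite ltn_neqAle m0 andbT; apply: contra_notN (maximal_proper maxP).
  by move=> /eqP m1; rewrite -m1 in Pm.
exists (pdiv m); split; first exact: pdiv_prime.
have p1 : (1 < pdiv m)%N by rewrite prime_gt1 ?pdiv_prime.
have mE : m = (m %/ pdiv m * pdiv m)%N by rewrite divnK ?pdiv_dvd.
rewrite mE natrM in Pm.
have [Pq|//] := maximal_prime maxP (integers_nat K _) (integers_nat K _) Pm.
have q0 : (0 < m %/ pdiv m)%N by rewrite divn_gt0 ?prime_gt0 ?pdiv_prime // dvdn_leq ?pdiv_dvd.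
have := m_min (m %/ pdiv m)%N; rewrite q0 leqNgt ltn_Pdiv //=.
by move=> H; have := H (introT (asboolP _) Pq).
Qed.

(** A family of least size that spans the integers modulo [P] with integer coefficients is a basis
    over Z/pZ: two distinct reduced expansions would give a relation with a coefficient prime to p,
    and Bezout would then eliminate one member. *)
Lemma is_residue_degree_exists P : is_maximal_ideal P ->
  exists d, is_residue_degree P d.
Proof.
move=> maxP; have [p_pr Pp] := residue_charP maxP; set p := residue_char P in p_pr Pp.
have [[subP PO] _] := maximal_nonzero maxP; have [P0 PB PZ] := subP.
pose spans d := exists b : 'I_d -> K, (forall i, OK (b i)) /\
  forall x, OK x -> exists z : 'I_d -> int, P (x - \sum_i (z i)%:~R * b i).
have exd : exists d, `[< spans d >].
  have [b [bO _ bZ]] := integral_basis K.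
  exists (\dim {:K}); apply/asboolP; exists b; split=> // x /bZ[z ->].
  by exists z; rewrite subrr.
case: (ex_minnP exd) => d /asboolP[b [bO bspan]] d_min.
exists d, b; split=> // x Ox.
have Pdvd (z : int) y : OK y -> (p %| z)%Z -> P (z%:~R * y).
  move=> Oy /dvdzP[q ->]; rewrite intrM mulrAC; apply: PZ => //.
  by apply: integersM => //; apply: integers_int.
have [z zP] := bspan x Ox.
have p0 : p%:Z != 0 by rewrite eqz_nat -lt0n prime_gt0.
have /fin_all_exists[c cP] (i : 'I_d) : exists k : 'I_p, (p %| z i - (k : nat)%:Z)%Z.
  by have [k [kP _]] := int_residue (z i) p0; exists k.
exists [ffun i => c i]; split=> [|c' c'P].
  have -> : x - \sum_i ([ffun i => c i] i)%:R * b i =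
      (x - \sum_i (z i)%:~R * b i) + \sum_i (z i - (c i : nat)%:Z)%:~R * b i.
    rewrite -addrA; congr (_ + _); rewrite -!sumrN -big_split /=.
    by apply: eq_bigr => i _; rewrite ffunE intrB mulrBl; ring.
  apply: submoduleD => //; apply: submodule_sum => // i _; exact: Pdvd.
apply/ffunP => j; rewrite ffunE; apply: contrapT => cj.
pose f i := (z i) - (c' i : nat)%:Z.
have Pf : P (\sum_i (f i)%:~R * b i).
  have -> : \sum_i (f i)%:~R * b i =
      (x - \sum_i (c' i)%:R * b i) - (x - \sum_i (z i)%:~R * b i).
    rewrite opprB addrC addrA subrK -sumrB.
    by apply: eq_bigr => i _; rewrite intrB mulrBl.
  exact: PB.
have nfj : ~~ (p %| f j)%Z.
  apply/negP => fj; apply: cj.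
  by have [k [_ ku]] := int_residue (z j) p0; rewrite -(ku (c j)) // -(ku (c' j)).
have [u [v uv]] := Bezoutz (f j) p.
have gcd1 : gcdz (f j) p = 1.
  apply/eqP; rewrite -[_ == _]/(coprimez _ _) coprimezE coprime_sym.
  by rewrite prime_coprime // -(dvdzE p%:Z).
rewrite {}gcd1 in uv.
have d0 : (0 < d)%N by apply: leq_ltn_trans (ltn_ord j).
suffices /(d_min d.-1) : `[< spans d.-1 >] by rewrite leqNgt ltn_predL d0.
apply/asboolP; exists (fun k => b (lift j k)); split=> [k|y Oy]; first exact: bO.
have [w wP] := bspan y Oy.
(* Modulo [P], u f_j is 1 and the sum of the f_i b_i is 0, so b_j is replaced by -u times the sum of
   the other f_k b_k. *)
exists (fun k => w (lift j k) - w j * u * f (lift j k)).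
have -> : y - \sum_k (w (lift j k) - w j * u * f (lift j k))%:~R * b (lift j k) =
    (y - \sum_i (w i)%:~R * b i) + ((w j * u)%:~R * (\sum_i (f i)%:~R * b i)
     + (w j * v * p%:Z)%:~R * b j).
  have -> : \sum_k (w (lift j k) - w j * u * f (lift j k))%:~R * b (lift j k) =
      \sum_k (w (lift j k))%:~R * b (lift j k)
      - (w j * u)%:~R * \sum_k (f (lift j k))%:~R * b (lift j k).
    rewrite mulr_sumr -sumrB; apply: eq_bigr => k _.
    by rewrite intrB mulrBl intrM mulrA.
  rewrite !(bigD1_ord j) //=.
  have := congr1 (fun c : int => c%:~R : K) uv; rewrite intrD !intrM => uvK.
  move: (\sum_k _) (\sum_k _) => S1 S2.
  have -> : (w j)%:~R * b j = (w j)%:~R * b j * (u%:~R * (f j)%:~R + v%:~R * p%:Z%:~R).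
    by rewrite uvK mulr1.
  ring.
apply: submoduleD => //; apply: submoduleD => //.
  by apply: PZ => //; apply: integers_int.
by apply: Pdvd; rewrite // dvdz_mull.
Qed.

Lemma residue_degree_gt0 P : is_maximal_ideal P -> (0 < residue_degree P)%N.
Proof.
move=> maxP; have : is_residue_degree P (residue_degree P).
  exact: xgetPex (is_residue_degree_exists maxP).
rewrite lt0n; apply: contraPneq => -> [b [_ /(_ 1 (integers1 K))[c [P1 _]]]].
by apply: (maximal_proper maxP); move: P1; rewrite big_ord0 subr0.
Qed.

Section FiniteClassNumber.
Variables (h : nat) (a : 'I_h -> set K).
Hypothesis ha : class_representatives a.

Lemma exact_power P x s k : is_maximal_ideal P -> maximal_seq s ->
    OK x -> principal x = ideal_prod s ->
  (ideal_exp P k x /\ ~ ideal_exp P k.+1 x) <-> k = count_mem P s.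
Proof.
move=> maxP maxs Ox xE.
have inE j : ideal_exp P j x <-> (j <= count_mem P s)%N.
  rewrite -(ideal_prod_sub_exp ha) // -xE; apply: iff_sym; apply: principal_sub.
  by apply: nonzero_ideal_submodule; apply: nonzero_ideal_exp; apply: maximal_nonzero.
rewrite !inE; split=> [[lek /negP]|->]; last by rewrite ltnn leqnn; split.
by rewrite -leqNgt => gek; apply/eqP; rewrite eqn_leq lek.
Qed.

(** [valuation] picks a value coming from some quotient representation x' / y'. All of them agree,
    because x y' = x' y gives two factorizations of one ideal, with equal multiplicities of [P]. *)
Lemma valuationE P x y s t : is_maximal_ideal P -> maximal_seq s -> maximal_seq t ->
    OK x -> OK y -> x != 0 -> y != 0 ->
    principal x = ideal_prod s -> principal y = ideal_prod t ->
  valuation P (x / y) = (count_mem P s)%:Z - (count_mem P t)%:Z.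
Proof.
move=> maxP maxs maxt Ox Oy x0 y0 xE yE; have nzP := maximal_nonzero maxP.
have : is_valuation P (x / y) (valuation P (x / y)).
  apply: (@xgetPex _ 0 (is_valuation P (x / y))); eexists; exists x, y, (count_mem P s), (count_mem P t).
  by split; rewrite // (exact_power _ maxP) //.
move=> [x' [y' [k [l [xyE xk yl ->]]]]].
have nz0 j w : ideal_exp P j w /\ ~ ideal_exp P j.+1 w -> w != 0 /\ OK w.
  move=> [Pw nPw]; split; last exact: ideal_exp_sub Pw.
  apply: contra_notN nPw => /eqP ->.
  by have [[[]]] := nonzero_ideal_exp j.+1 nzP.
have [x'0 Ox'] := nz0 _ _ xk; have [y'0 Oy'] := nz0 _ _ yl.
have [s' maxs' x'E] := exists_factorization ha (nonzero_ideal_principal Ox' x'0).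
have [t' maxt' y'E] := exists_factorization ha (nonzero_ideal_principal Oy' y'0).
move/(exact_power _ maxP maxs' Ox' x'E): xk => ->.
move/(exact_power _ maxP maxt' Oy' y'E): yl => ->.
have cross : x * y' = x' * y.
  by apply/eqP; rewrite -eqr_div // xyE.
have := congr1 (@principal K) cross; rewrite -!principalM xE yE x'E y'E.
rewrite -!ideal_prod_cat // => /(eq_count_ideal_prod ha _ _ maxP).
move/(_ (maximal_seq_cat maxs maxt') (maximal_seq_cat maxs' maxt)).
rewrite !count_cat; lia.
Qed.

Lemma ramification_index_gt0 P : is_maximal_ideal P -> (0 < ramification_index P)%N.
Proof.
move=> maxP; have [p_pr Pp] := residue_charP maxP; rewrite /ramification_index.
set p := residue_char P in p_pr Pp *.
have p0 : p%:R != 0 :> K by rewrite natr_eq0_numfield -lt0n prime_gt0.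
have [s maxs sE] := exists_factorization ha (nonzero_ideal_principal (integers_nat K p) p0).
rewrite -[p%:R]divr1 (@valuationE _ _ _ s [::]) ?principal1 ?oner_neq0 //;
  [|exact: integers_nat|exact: integers1].
rewrite subr0 absz_nat -(ideal_prod_sub_exp ha) // -sE.
have subP := nonzero_ideal_submodule (maximal_nonzero maxP).
apply/principal_sub; first by apply: ideal_mul_submodule.
by rewrite /= ideal_mulC ideal_mul1.
Qed.

Variable R : realType.

(** The local degree e f cancels the denominator e f of the exponent in [place_abs], both being
    positive, and leaves N(P) to the power -v(x / y). *)
Lemma place_abs_finite P x y s t : is_maximal_ideal P -> maximal_seq s -> maximal_seq t ->
    OK x -> OK y -> x != 0 -> y != 0 ->
    principal x = ideal_prod s -> principal y = ideal_prod t ->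
  place_abs (@FinitePlace R K P) (x / y) ^+ local_degree (@FinitePlace R K P)
  = (idealN P)%:R ^+ count_mem P t / (idealN P)%:R ^+ count_mem P s.
Proof.
move=> maxP maxs maxt Ox Oy x0 y0 xE yE.
rewrite /place_abs /local_degree (negbTE (mulf_neq0 _ _)) ?invr_eq0 //.
rewrite (valuationE maxP maxs maxt) //.
set e := (_ * _)%N; have e0 : e%:R != 0 :> R.
  by rewrite pnatr_eq0 -lt0n muln_gt0 ramification_index_gt0 ?residue_degree_gt0.
have N0 : (idealN P)%:R != 0 :> R.
  by rewrite pnatr_eq0 -lt0n (ltn_trans _ (maximal_idealN_gt1 maxP)).
rewrite -powR_mulrn ?powR_ge0 // -powRrM divfK // intrB opprB.
apply: (mulIf (expf_neq0 (count_mem P s) N0)); rewrite divfK ?expf_neq0 //.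
rewrite -!powR_mulrn // -powRD ?(negbTE N0) ?implybT //.
by rewrite !pmulrn subrK.
Qed.

End FiniteClassNumber.
End FinitePlaces.

(** * Archimedean places *)

Section ArchimedeanPlaces.
Variables (R : realType) (K : fieldExtType rat).
Local Notation n := (\dim {:K}).
Local Notation normc := Normc.normc.

Lemma normc_ge0 (z : R[i]) : 0 <= normc z.
Proof. by case: z => u v; apply: sqrtr_ge0. Qed.

Lemma normc_conjc (z : R[i]) : normc (conjc z) = normc z.
Proof. by case: z => u v; rewrite /= sqrrN. Qed.

Lemma normc_norm (z : R[i]) : (normc z)%:C%C = `|z|.
Proof. by rewrite normc_def; case: z. Qed.

Lemma normc_real (x : R) : normc (x%:C)%C = `|x|.
Proof. by rewrite /= expr0n /= addr0 sqrtr_sqr. Qed.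

Lemma normc_prod (I : finType) (F : I -> R[i]) :
  normc (\prod_i F i) = \prod_i normc (F i).
Proof. by apply: (big_morph _ (@Normc.normcM R)); apply: Normc.normc1. Qed.

Variable s : 'I_n -> {rmorphism K -> R[i]}.
Hypothesis s_inj : exists t, injective (fun i => s i t).
Hypothesis s_all : forall f : {rmorphism K -> R[i]}, exists i, f =1 s i.

Definition real_index i := `[< forall x, complex.Im (s i x) = 0 >].

(** Two-to-one on nonreal embeddings: conjugate ones give the same unordered pair. *)
Definition arch_place i : place R K :=
  if real_index i then RealPlace (fun x => complex.Re (s i x))
  else ComplexPlace [set (s i : K -> R[i]); conj_embedding (s i)].

Lemma embedding_index_inj i j : s i =1 s j -> i = j.
Proof. by case: s_inj => t t_inj sij; apply: t_inj. Qed.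

Lemma real_index_complexE i x : real_index i -> s i x = (complex.Re (s i x))%:C%C.
Proof. by move=> /asboolP/(_ x); case: (s i x) => u v /= ->. Qed.

Lemma nonreal_index i : ~~ real_index i -> exists x, complex.Im (s i x) != 0.
Proof.
move=> /asboolPn nri; apply: contrapT => im0; apply: nri => x.
by apply: contrapT => /eqP imx; apply: im0; exists x.
Qed.

Lemma arch_place_in i : @places R K (arch_place i).
Proof.
rewrite /arch_place; case: ifPn => [ri|/nonreal_index nri] /=.
  pose f x := complex.Re (s i x).
  have fE x : (f x)%:C%C = s i x by rewrite -real_index_complexE.
  have fB : zmod_morphism f by move=> x y; apply: complexI; rewrite rmorphB /= !fE rmorphB.
  have fM : monoid_morphism f.
    by split=> [|x y]; apply: complexI; rewrite ?rmorphM /= !fE ?rmorph1 ?rmorphM.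
  pose fA := GRing.isZmodMorphism.Build K R f fB.
  pose fMM := GRing.isMonoidMorphism.Build K R f fM.
  pose F : {rmorphism K -> R} := HB.pack f fA fMM.
  by exists F.
by exists (s i) => //; split=> //; exists (s i).
Qed.

Lemma arch_place_surj v : @places R K v ->
  (exists i, v = arch_place i) \/ exists2 P, is_maximal_ideal P & v = @FinitePlace R K P.
Proof.
case: v => [f [F ->]|T [t [[F ->] [x0 imx0]] ->]|P maxP]; last by right; exists P.
  left; have [i iE] := s_all (GRing.RMorphism.clone _ _ (real_complex R \o F) _).
  exists i; have ri : real_index i by apply/asboolP => x; rewrite -iE.
  by rewrite /arch_place ri; congr RealPlace; apply/funext => x; rewrite -iE.
left; have [i iE] := s_all F; exists i; rewrite /arch_place.
have FE : (F : K -> R[i]) = s i by apply/funext.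
rewrite ifN ?FE //; apply/asboolPn => /(_ x0)/eqP; rewrite -iE.
by rewrite (negbTE imx0).
Qed.

Lemma max1_sqr (y : R) : 0 <= y -> Num.max (y ^+ 2) 1 = Num.max y 1 ^+ 2.
Proof.
move=> y0; have [y1|y1] := leP y 1; last first.
  by rewrite max_l // exprn_ege1 // ltW.
by rewrite max_r ?expr1n // exprn_ile1.
Qed.

(** One embedding lies above a real place. Above a complex place lie [i] and its conjugate, which
    have the same modulus; their two equal factors account for the local degree 2. *)
Lemma arch_place_factor i x :
  Num.max (place_abs (arch_place i) x ^+ local_degree (arch_place i)) 1 =
  \prod_(k | arch_place k == arch_place i) Num.max (normc (s k x)) 1.
Proof.
have [ri|nri] := boolP (real_index i).
  rewrite (big_pred1 i) => [|k] /=.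
    rewrite {1 2}/arch_place ri /= expr1 {2}(real_index_complexE x ri).
    by rewrite normc_real.
  apply/eqP/eqP => [|->] //; rewrite /arch_place ri.
  case: ifP => // rk [sE]; apply: embedding_index_inj => y.
  by rewrite (real_index_complexE y rk) (real_index_complexE y ri) (congr1 (fun f => f y) sE).
have [y0 imy0] := nonreal_index nri.
have [j jE] := s_all (GRing.RMorphism.clone _ _ (conjc \o s i) _).
have ij : j != i.
  apply: contra imy0 => /eqP jiE; have := jE y0; rewrite jiE /=.
  case: (s i y0) => u v /= [] /eqP; rewrite -subr_eq0 -opprD oppr_eq0.
  by rewrite -mulr2n mulrn_eq0.
have conjE (f : K -> R[i]) : f =1 s j <-> f = conj_embedding (s i).
  split=> [fE|-> y]; last by rewrite -jE.
  by apply/funext => y; rewrite fE -jE.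
have kE k : (arch_place k == arch_place i) = (k == i) || (k == j).
  apply/eqP/orP => [|[/eqP -> //|/eqP ->]].
    rewrite /arch_place (negbTE nri); case: ifP => // rk [TE].
    have : [set (s i : K -> R[i]); conj_embedding (s i)] (s k) by rewrite -TE; left.
    move=> [skE|/conjE skE]; [left|right]; apply/eqP/embedding_index_inj => // y.
    by rewrite skE.
  have nrj : ~~ real_index j.
    apply/asboolPn => /(_ y0); rewrite -jE /= => /eqP.
    by case: (s i y0) imy0 => u v /= v0; rewrite oppr_eq0 (negbTE v0).
  rewrite /arch_place (negbTE nri) (negbTE nrj); congr ComplexPlace.
  have -> : (s j : K -> R[i]) = conj_embedding (s i) by apply/conjE.
  have -> : conj_embedding (conj_embedding (s i)) = s i.
    by apply/funext => y; rewrite /conj_embedding conjcK.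
  by rewrite setUC.
rewrite (bigD1 i) ?kE ?eqxx //= (bigD1 j) ?kE ?eqxx ?orbT //= big1 ?mulr1; last first.
  by move=> k; rewrite kE => /andP[/andP[/orP[] /eqP ->]]; rewrite eqxx.
rewrite -jE /= normc_conjc -expr2 -max1_sqr ?normc_ge0 //.
rewrite /arch_place (negbTE nri) /=; set T := [set _; _].
have : T (xget (fun=> 0) T) by apply: (@xgetPex _ _ T); exists (s i : K -> R[i]); left.
by case=> -> //; rewrite normc_conjc.
Qed.

Lemma prod_arch_places x :
  \prod_(v <- undup [seq arch_place i | i <- enum 'I_n])
     Num.max (place_abs v x ^+ local_degree v) 1 =
  \prod_i Num.max (normc (s i x)) 1.
Proof.
set L := undup _; have Lin i : arch_place i \in L.
  by rewrite mem_undup map_f ?mem_enum.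
transitivity (\prod_(v <- L) \prod_(k | arch_place k == v) Num.max (normc (s k x)) 1).
  apply: eq_big_seq => v; rewrite mem_undup => /mapP[i _ ->].
  exact: arch_place_factor.
under eq_bigr do rewrite big_mkcond.
rewrite exchange_big /=; apply: eq_bigr => k _.
rewrite (bigD1_seq (arch_place k)) ?undup_uniq //= eqxx big1 ?mulr1 // => v vk.
by rewrite eq_sym (negbTE vk).
Qed.

End ArchimedeanPlaces.

(** * Heights *)

Section HeightFormula.
Variable K : fieldExtType rat.
Implicit Types (I M : set K) (x y c : K).
Local Notation n := (\dim {:K}).
Local Notation OK := (@integers K).
Local Notation normc := Normc.normc.

Lemma gen2_submodule x y : is_submodule (gen2 x y).
Proof.
split.
- by exists 0; [apply: integers0|exists 0; [apply: integers0|rewrite !mul0r addr0]].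
- move=> _ _ [c Oc [d Od <-]] [c' Oc' [d' Od' <-]].
  exists (c - c'); first exact: integersB.
  by exists (d - d'); [apply: integersB|ring].
- move=> e _ Oe [c Oc [d Od <-]]; exists (e * c); first exact: integersM.
  by exists (e * d); [apply: integersM|ring].
Qed.

Lemma gen2l x y : gen2 x y x.
Proof.
by exists 1; [apply: integers1|exists 0; [apply: integers0|rewrite mul1r mul0r addr0]].
Qed.

Lemma gen2r x y : gen2 x y y.
Proof.
by exists 0; [apply: integers0|exists 1; [apply: integers1|rewrite mul1r mul0r add0r]].
Qed.

Lemma gen2_min M x y : is_submodule M -> M x -> M y -> gen2 x y `<=` M.
Proof.
move=> subM Mx My _ [c Oc [d Od <-]]; have [_ _ MZ] := subM.
by apply: submoduleD => //; apply: MZ.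
Qed.

Lemma gen2C x y : gen2 x y = gen2 y x.
Proof.
by apply/seteqP; split; apply: gen2_min;
  by [apply: gen2_submodule|apply: gen2l|apply: gen2r].
Qed.

Lemma gen2_scale c x y : gen2 (c * x) (c * y) = [set c * z | z in gen2 x y].
Proof.
apply/seteqP; split=> [_ [u Ou [v Ov <-]]|_ [_ [u Ou [v Ov <-]] <-]].
  by exists (u * x + v * y); [exists u => //; exists v|ring].
by exists u => //; exists v => //; ring.
Qed.

Lemma gen2_nonzero_ideal x y : OK x -> OK y -> x != 0 -> nonzero_ideal (gen2 x y).
Proof.
move=> Ox Oy x0; split; last by exists x => //; apply: gen2l.
split; first exact: gen2_submodule.
by apply: gen2_min => //; apply: integers_submodule.
Qed.

Section FiniteClassNumber.
Variables (h : nat) (a : 'I_h -> set K).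
Hypothesis ha : class_representatives a.

(** If [Q] divided both cofactors, [x] and [y] would lie in Q (x, y), and Nakayama would put 1 in
    [Q]. *)
Lemma count_coprime_part x y (sb sc : seq (set K)) Q :
    OK x -> OK y -> x != 0 -> y != 0 -> maximal_seq sb -> maximal_seq sc ->
    principal x = ideal_mul (gen2 x y) (ideal_prod sc) ->
    principal y = ideal_mul (gen2 x y) (ideal_prod sb) ->
    is_maximal_ideal Q ->
  count_mem Q sb = 0%N \/ count_mem Q sc = 0%N.
Proof.
move=> Ox Oy x0 y0 maxb maxc xE yE maxQ; apply: contrapT => nQ.
have nzQ := maximal_nonzero maxQ; have [[subQ QO] _] := nzQ.
have subg := gen2_submodule x y.
have Q1 : ideal_exp Q 1 = Q by rewrite /= ideal_mulC ideal_mul1.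
have [bQ cQ] : ideal_prod sb `<=` Q /\ ideal_prod sc `<=` Q.
  rewrite -Q1 !(ideal_prod_sub_exp ha) // !lt0n.
  by split; apply/negP => /eqP E; apply: nQ; [left|right].
apply: (maximal_proper maxQ); apply: (nakayama (M := gen2 x y)) => //.
  exact: gen2_nonzero_ideal.
rewrite ideal_mulC; apply: gen2_min; first exact: ideal_mul_submodule.
  by apply: (ideal_mulS (fun _ => id) cQ); rewrite -xE; apply: principal_id.
by apply: (ideal_mulS (fun _ => id) bQ); rewrite -yE; apply: principal_id.
Qed.

Variable R : realType.
Variable s : 'I_n -> {rmorphism K -> R[i]}.
Hypothesis s_inj : exists t, injective (fun i => s i t).
Hypothesis s_all : forall f : {rmorphism K -> R[i]}, exists i, f =1 s i.

Lemma idealN_principal x : OK x -> x != 0 ->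
  (idealN (principal x))%:R = \prod_i normc (s i x).
Proof.
move=> Ox x0; have [_ /(_ _ s s_inj)] := principal_residues Ox x0.
rewrite -normc_norm normc_prod => NE.
by apply: (@complexI R); rewrite -NE rmorph_nat.
Qed.

(** Write (x) = (x, y) C and (y) = (x, y) B with B and C coprime. The finite places contribute N(B)
    = N((y)) / N((x, y)), and N((y)), the product of the |s y|, turns each max(|s x / s y|, 1) into
    max(|s x|, |s y|). *)
Lemma height_formula x y : OK x -> OK y -> x != 0 -> y != 0 ->
  height R (x / y) =
    (\prod_i Num.max (normc (s i x)) (normc (s i y))) / (idealN (gen2 x y))%:R.
Proof.
move=> Ox Oy x0 y0; have nzg := gen2_nonzero_ideal Ox Oy x0.
have subg := gen2_submodule x y.
have [nzx nzy] := (nonzero_ideal_principal Ox x0, nonzero_ideal_principal Oy y0).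
have [|C nzC xE] := ideal_divides ha nzx nzg.
  by apply/principal_sub => //; apply: gen2l.
have [|B nzB yE] := ideal_divides ha nzy nzg.
  by apply/principal_sub => //; apply: gen2r.
have [sa maxa gE] := exists_factorization ha nzg.
have [sb maxb BE] := exists_factorization ha nzB.
have [sc maxc CE] := exists_factorization ha nzC.
rewrite {}BE in yE nzB; rewrite {}CE in xE nzC.
have xE' : principal x = ideal_prod (sa ++ sc) by rewrite ideal_prod_cat // -gE.
have yE' : principal y = ideal_prod (sa ++ sb) by rewrite ideal_prod_cat // -gE.
pose F (v : place R K) := Num.max (place_abs v (x / y) ^+ local_degree v) 1.
have FE Q : is_maximal_ideal Q ->
    F (@FinitePlace R K Q) = (idealN Q)%:R ^+ count_mem Q sb.
  move=> maxQ; rewrite /F (place_abs_finite ha _ maxQ (maximal_seq_cat maxa maxc)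
    (maximal_seq_cat maxa maxb)) // !count_cat !exprD.
  have N1 : 1 <= (idealN Q)%:R :> R by rewrite ler1n ltnW // maximal_idealN_gt1.
  have N0 : (idealN Q)%:R != 0 :> R by rewrite gt_eqF // (lt_le_trans ltr01).
  rewrite -mulf_div divff ?expf_neq0 // mul1r.
  have [->|->] := count_coprime_part Ox Oy x0 y0 maxb maxc xE yE maxQ.
    by rewrite expr0 max_r // div1r invf_le1 ?exprn_ege1 // exprn_gt0 // lt0r N0 ler0n.
  by rewrite expr0 divr1 max_l // exprn_ege1.
pose La := undup [seq arch_place s i | i <- enum 'I_n].
(* Places outside this list contribute 1, so the height becomes a finite product over it. *)
pose L := [seq @FinitePlace R K P | P <- undup sb] ++ La.
have La_arch v : v \in La -> exists i, v = arch_place s i.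
  by rewrite mem_undup => /mapP[i _ ->]; exists i.
have L_places v : v \in L -> @places R K v.
  rewrite mem_cat => /orP[/mapP[P]|/La_arch[i ->]]; last exact: arch_place_in.
  by rewrite mem_undup => /maxb maxP ->.
have uL : uniq L.
  rewrite cat_uniq undup_uniq map_inj_uniq ?undup_uniq; last by move=> P Q [].
  rewrite andbT /=; apply/hasPn => v /La_arch[i ->]; apply/mapP => -[P _].
  by rewrite /arch_place; case: ifP.
have heightE : height R (x / y) = \prod_(v <- L) F v.
  rewrite /height (fsbigE L) //.
    rewrite [LHS]big_seq_cond [RHS]big_seq; apply: eq_bigl => v.
    by case: (boolP (v \in L)) => //= vL; exact/mem_set/L_places.
  move=> v /(arch_place_surj s_all)[[i ->]|[P maxP ->]] nL.
    by case/negP: nL; rewrite mem_cat mem_undup map_f ?orbT ?mem_enum.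
  rewrite -/(F _) FE //; suff -> : count_mem P sb = 0%N by [].
  apply/count_memPn; apply: contra nL => Psb.
  by rewrite mem_cat map_f ?mem_undup.
have Ng0 : (idealN (gen2 x y))%:R != 0 :> R.
  by rewrite pnatr_eq0 -lt0n idealN_gt0.
have NB : (idealN (ideal_prod sb))%:R = (idealN (principal y))%:R / (idealN (gen2 x y))%:R :> R.
  by rewrite yE (idealNM ha) // natrM mulrC mulKf.
rewrite heightE big_cat /= big_map (prod_arch_places s_inj s_all).
have -> : \prod_(P <- undup sb) F (@FinitePlace R K P) = (idealN (ideal_prod sb))%:R.
  rewrite (idealN_prod ha) // natr_prod -[RHS]big_undup_iterop_count.
  by apply: eq_big_seq => P; rewrite mem_undup => /maxb; apply: FE.
rewrite NB (idealN_principal Oy y0) mulrAC -big_split /=; congr (_ / _).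
apply: eq_bigr => i _; have ny0 : 0 < normc (s i y).
  rewrite lt0r normc_ge0 andbT; apply: contraNneq y0 => /Normc.eq0_normc/eqP.
  by rewrite fmorph_eq0.
rewrite fmorph_div Normc.normcM Normc.normcV maxr_pMr ?mulr1; last exact: ltW.
by rewrite mulrCA divff ?mulr1 // gt_eqF.
Qed.

End FiniteClassNumber.
End HeightFormula.

(** * Units, roots of unity and associated generators *)

Section Units.
Variable K : fieldExtType rat.
Implicit Types (x y u v z : K).
Local Notation OK := (@integers K).

Lemma unit_groupP u : unit_group u <-> [/\ u != 0, OK u & OK u^-1].
Proof.
split=> [[Ou [v Ov uv]]|[u0 Ou Ov]]; last first.
  by split=> //; exists u^-1; rewrite ?divff.
have u0 : u != 0 by apply: contra_eq_neq uv => ->; rewrite mul0r eq_sym oner_neq0.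
by split=> //; rewrite -[u^-1]mulr1 -uv mulKf.
Qed.

Lemma unit_group_neq0 u : unit_group u -> u != 0.
Proof. by case/unit_groupP. Qed.

Lemma unit_groupV u : unit_group u -> unit_group u^-1.
Proof. by move=> /unit_groupP[u0 Ou Ov]; apply/unit_groupP; rewrite invr_eq0 invrK. Qed.

Lemma unit_groupM u v : unit_group u -> unit_group v -> unit_group (u * v).
Proof.
move=> /unit_groupP[u0 Ou Ou'] /unit_groupP[v0 Ov Ov']; apply/unit_groupP.
by rewrite mulf_neq0 // invfM; split=> //; apply: integersM.
Qed.

Lemma unit_group1 : unit_group (1 : K).
Proof.
by apply/unit_groupP; rewrite invr1 oner_neq0; split=> //; apply: integers1.
Qed.

Lemma unit_groupXz u (k : int) : unit_group u -> unit_group (u ^ k).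
Proof.
move=> Uu; have UX m : unit_group (u ^+ m).
  elim: m => [|m IH]; first exact: unit_group1.
  by rewrite exprS; apply: unit_groupM.
by case: k => m; [apply: UX|apply: unit_groupV].
Qed.

Lemma unit_group_monomial r (eps : 'I_r -> K) (k : {ffun 'I_r -> int}) :
  fundamental_units eps -> unit_group (unit_monomial eps k).
Proof.
move=> [Ueps _]; apply: (big_ind (@unit_group K)); first exact: unit_group1.
  exact: unit_groupM.
by move=> i _; apply: unit_groupXz.
Qed.

Lemma unit_monomialN r (eps : 'I_r -> K) (k : {ffun 'I_r -> int}) :
  unit_monomial eps [ffun i => - k i] = (unit_monomial eps k)^-1.
Proof.
by rewrite /unit_monomial -prodfV; apply: eq_bigr => i _; rewrite ffunE invr_expz.
Qed.

Lemma roots_of_unityV z : roots_of_unity z -> roots_of_unity z^-1.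
Proof. by case=> k k0 zk; exists k; rewrite // exprVn zk invr1. Qed.

Lemma roots_of_unityM z u : roots_of_unity z -> roots_of_unity u -> roots_of_unity (z * u).
Proof.
move=> [k k0 zk] [m m0 um]; exists (k * m)%N; first by rewrite muln_gt0 k0.
by rewrite exprMn exprM zk expr1n mul1r mulnC exprM um expr1n.
Qed.

Lemma roots_of_unity1 : roots_of_unity (1 : K).
Proof. by exists 1%N. Qed.

Lemma roots_of_unity_unit z : roots_of_unity z -> unit_group z.
Proof.
move=> [[//|k] _ zk]; have z0 : z != 0.
  by apply: contra_eq_neq zk => ->; rewrite expr0n eq_sym oner_neq0.
have Oz : OK z.
  exists ('X^(k.+1) - 1); first exact: monicXnsubC.
  by rewrite rmorphB rmorph1 /= map_polyXn rootE !hornerE zk subrr.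
split=> //; exists (z ^+ k); first exact: integersX.
by rewrite -exprS.
Qed.

Lemma principal_unit u x : unit_group u -> principal (u * x) = principal x.
Proof.
move=> /unit_groupP[u0 Ou Ov]; apply/seteqP; split=> _ [c Oc <-].
  by exists (c * u); [apply: integersM|rewrite mulrA].
by exists (c / u); [apply: integersM|rewrite mulrA divfK].
Qed.

Lemma principal_eq_unit x y : x != 0 -> principal x = principal y ->
  exists2 u, unit_group u & x = u * y.
Proof.
move=> x0 xy; have [u Ou ux] : principal y x by rewrite -xy; apply: principal_id.
have [v Ov vy] : principal x y by rewrite xy; apply: principal_id.
exists u => //; split=> //; exists v => //; apply: (mulIf x0).
by rewrite mul1r -mulrA vy.
Qed.

Lemma gen2_principal x y x' y' : principal x = principal x' ->
  principal y = principal y' -> gen2 x y = gen2 x' y'.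
Proof.
suffices H u v u' v' : principal u = principal u' -> principal v = principal v' ->
    gen2 u v `<=` gen2 u' v'.
  by move=> xx yy; apply/seteqP; split; apply: H.
move=> uu vv; have subg := gen2_submodule u' v'.
apply: gen2_min => //; apply/principal_sub => //.
  by rewrite uu; apply/principal_sub => //; apply: gen2l.
by rewrite vv; apply/principal_sub => //; apply: gen2r.
Qed.

End Units.

Section Heights.
Variables (R : realType) (K : fieldExtType rat).
Implicit Types (x y z : K).
Local Notation OK := (@integers K).
Variables (h : nat) (a : 'I_h -> set K).
Hypothesis ha : class_representatives a.

Lemma integer_quotient z : exists x y, [/\ OK x, OK y, y != 0 & z = x / y].
Proof.
have [m [m0 Omz]] := clear_denominator z.
have mK : m%:R != 0 :> K by rewrite natr_eq0_numfield -lt0n.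
exists (m%:R * z), m%:R; split=> //; first exact: integers_nat.
by rewrite mulrC mulKf.
Qed.

Lemma integer_quotient_neq0 z : z != 0 ->
  exists x y, [/\ OK x, OK y, x != 0, y != 0 & z = x / y].
Proof.
move=> z0; have [x [y [Ox Oy y0 zE]]] := integer_quotient z.
exists x, y; split=> //; apply: contraNneq z0 => x0.
by rewrite zE x0 mul0r.
Qed.

Lemma height_ge0 z : z != 0 -> 0 <= height R z.
Proof.
move=> /integer_quotient_neq0[x [y [Ox Oy x0 y0 ->]]].
have [t [s [s_inj s_all]]] := exists_embeddings K R[i].
rewrite (height_formula ha (ex_intro _ t s_inj) s_all) // divr_ge0 //.
by apply: prodr_ge0 => i _; rewrite le_max normc_ge0.
Qed.

Lemma heightV z : z != 0 -> height R z^-1 = height R z.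
Proof.
move=> /integer_quotient_neq0[x [y [Ox Oy x0 y0 ->]]].
have [t [s [s_inj s_all]]] := exists_embeddings K R[i].
rewrite invf_div !(height_formula ha (ex_intro _ t s_inj) s_all) // gen2C.
by congr (_ / _); apply: eq_bigr => i _; rewrite maxC.
Qed.

(** The maxima are submultiplicative, and (x x', y y') is contained in (x, y)(x', y'), so the norm
    in the denominator can only grow. *)
Lemma heightM_le z w : z != 0 -> w != 0 -> height R (z * w) <= height R z * height R w.
Proof.
move=> /integer_quotient_neq0[x [y [Ox Oy x0 y0 ->]]].
move=> /integer_quotient_neq0[x' [y' [Ox' Oy' x'0 y'0 ->]]].
have [t [s [s_inj s_all]]] := exists_embeddings K R[i].
have HF := height_formula ha (ex_intro _ t s_inj) s_all.
rewrite mulf_div !HF ?mulf_neq0 //; try exact: integersM.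
rewrite mulf_div -big_split /=.
have nzg := gen2_nonzero_ideal Ox Oy x0; have nzg' := gen2_nonzero_ideal Ox' Oy' x'0.
have nzgg : nonzero_ideal (gen2 (x * x') (y * y')).
  by apply: gen2_nonzero_ideal; [apply: integersM|apply: integersM|apply: mulf_neq0].
have subgg : is_submodule (ideal_mul (gen2 x y) (gen2 x' y')).
  exact/ideal_mul_submodule/gen2_submodule.
apply: ler_pM.
- by apply: prodr_ge0 => i _; rewrite le_max normc_ge0.
- by rewrite invr_ge0.
- apply: ler_prod => i _; rewrite le_max !rmorphM !Normc.normcM mulr_ge0 ?normc_ge0 //=.
  by rewrite ge_max !ler_pM ?normc_ge0 ?le_max ?lexx ?orbT.
rewrite -natrM -(idealNM ha) // lef_pV2 ?posrE ?ltr0n ?idealN_gt0 //; last first.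
  exact: nonzero_ideal_mul.
have sub : gen2 (x * x') (y * y') `<=` ideal_mul (gen2 x y) (gen2 x' y').
  by apply: gen2_min => //; apply: ideal_mul_in;
    [apply: gen2l|apply: gen2l|apply: gen2r|apply: gen2r].
rewrite ler_nat.
by have [] := idealNS (gen2_submodule _ _) subgg sub (finite_cosets_ideal nzgg).
Qed.

Lemma height_root_of_unity z : roots_of_unity z -> height R z = 1.
Proof.
move=> mu_z; have /unit_groupP[z0 Oz _] := roots_of_unity_unit mu_z.
have [t [s [s_inj s_all]]] := exists_embeddings K R[i].
rewrite -[z]divr1 (height_formula ha (ex_intro _ t s_inj) s_all) ?oner_neq0 //; last exact: integers1.
have [idg _] := gen2_nonzero_ideal Oz (integers1 K) z0.
rewrite (ideal_eq_integers idg (gen2r _ _)) idealN_integers divr1.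
rewrite big1 // => i _; rewrite rmorph1 Normc.normc1.
case: mu_z => k k0 zk; have /eqP : Normc.normc (s i z) ^+ k = 1.
  rewrite -(Normc.normc1 R) -(rmorph1 (s i)) -zk rmorphXn.
  by elim: k {k0 zk} => [|k IH]; rewrite ?expr0 ?Normc.normc1 // !exprS Normc.normcM IH.
by rewrite pexprn_eq1 ?normc_ge0 // eqn0Ngt k0 /= => /eqP ->; rewrite maxxx.
Qed.

(** With (x, y) = a_l and H(x / y) <= B this is the norm bound required by [bounded_principal]. *)
Lemma idealN_principal_le_height x y : OK x -> OK y -> x != 0 -> y != 0 ->
  (idealN (principal y))%:R <= height R (x / y) * (idealN (gen2 x y))%:R.
Proof.
move=> Ox Oy x0 y0; have [t [s [s_inj s_all]]] := exists_embeddings K R[i].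
have s_inj' : exists t, injective (fun i => s i t) by exists t.
have nzg := gen2_nonzero_ideal Ox Oy x0.
rewrite (height_formula ha s_inj' s_all) // divfK; last first.
  by rewrite pnatr_eq0 -lt0n idealN_gt0.
rewrite (idealN_principal s_inj') //; apply: ler_prod => i _.
by rewrite normc_ge0 le_max lexx orbT.
Qed.

End Heights.

(** * Packets *)

Section PacketUniqueness.
Variables (R : realType) (K : fieldExtType rat) (h : nat) (a : 'I_h -> set K).
Hypothesis ha : class_representatives a.
Variables (B : R) (s : 'I_h -> nat) (g : forall l, 'I_(s l) -> K).
Hypothesis hg : bounded_generators B a g.

Lemma bounded_generator_neq0 l (i : 'I_(s l)) : g i != 0.
Proof.
have [/(_ i)[_ [_ [x [c _ <-]] cg0 _ _]] _] := hg l.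
by apply: contraNneq cg0 => ->; rewrite mulr0.
Qed.

Lemma bounded_generator_inj l (i j : 'I_(s l)) :
  principal (g i) = principal (g j) -> i = j.
Proof.
move=> ij; have [/(_ i)[_ bi] /(_ _ bi)[k [_ ku]]] := hg l.
by rewrite -(ku i) // -(ku j).
Qed.

(* The equality of the dependent triples (l, i, j) and (l', i', j') is stated
   in Leibniz form. *)
Lemma packet_index_unique l l' (i j : 'I_(s l)) (i' j' : 'I_(s l')) v :
    unit_group v -> gen2 (g i) (g j) = a l -> gen2 (g i') (g j') = a l' ->
    g i' / g j' = v * (g i / g j) ->
  forall Q : (forall l, 'I_(s l) -> 'I_(s l) -> Prop), Q l i j -> Q l' i' j'.
Proof.
move=> Uv gl gl' E.
have [gi0 gj0] := (bounded_generator_neq0 i, bounded_generator_neq0 j).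
have gj'0 := bounded_generator_neq0 j'.
pose t := g j' / g j.
have t0 : t != 0 by rewrite mulf_neq0 ?invr_eq0.
have jE : g j' = t * g j by rewrite /t divfK.
have iE : g i' = t * (v * g i).
  by rewrite -[LHS](divfK gj'0) E /t; field.
have aE : a l' = [set t * x | x in a l].
  by rewrite -gl' iE jE gen2_scale (gen2_principal (principal_unit _ Uv) (erefl _)) gl.
have [a_ideal a_uniq] := ha.
have [l0 [_ lu]] := a_uniq _ (fractional_nonzero_ideal (a_ideal l')).
have ll' : l = l'.
  have -> : l = l0 by apply/esym/lu; exists t.
  apply: lu; exists 1; first exact: oner_neq0.
  by apply/seteqP; split=> [x ax|_ [x ax <-]]; [exists x|]; rewrite ?mul1r.
case: _ / ll' in i' j' gl' E gj'0 t t0 jE iE aE lu *.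
have nza : nonzero_ideal (a l) := a_ideal l.
(* [t] maps [a l] onto itself, so its inverse stabilizes [a l] too. *)
have Ut : unit_group t.
  apply/unit_groupP; split=> //; apply: (stable_ideal_integral nza) => x.
    by move=> ax; rewrite aE; exists x.
  by rewrite {1}aE => -[y ay <-]; rewrite mulKf.
have -> : i' = i.
  by apply: bounded_generator_inj; rewrite iE !principal_unit.
have -> : j' = j by apply: bounded_generator_inj; rewrite jE principal_unit.
by [].
Qed.

End PacketUniqueness.

Theorem theorem3p1 (R : realType) (K : fieldExtType rat)
    (h : nat) (a : 'I_h -> set K) (ha : class_representatives a)
    (r : nat) (eps : 'I_r -> K) (heps : fundamental_units eps)
    (B : R) (hB : 1 <= B)
    (s : 'I_h -> nat) (g : forall l, 'I_(s l) -> K)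
    (hg : bounded_generators B a g) :
  (forall x : K, x != 0 -> height R x <= B ->
     unit_group x \/
     exists2 P : packet r s, is_packet B a eps g P & packet_set eps g P x) /\
  (forall P P' : packet r s,
     is_packet B a eps g P -> is_packet B a eps g P' -> P <> P' ->
     packet_set eps g P `&` packet_set eps g P' = set0).
Proof.
split.
- move=> x x0 hx; have [a_ideal a_class] := ha.
  have [m [m0 Omx]] := clear_denominator x.
  have mK : m%:R != 0 :> K by rewrite natr_eq0_numfield -lt0n.
  have fracx : is_fractional_ideal (gen2 x 1).
    split; first exact: gen2_submodule.
      by exists x => //; apply: gen2l.
    exists m%:R; split=> //; first exact: integers_nat.
    move=> _ [c Oc [d Od <-]]; rewrite mulrDr mulr1 mulrCA.
    by apply: integersD; apply: integersM => //; apply: integers_nat.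
  have [l [[c c0 cE] _]] := a_class _ fracx.
  pose y := x / c; pose z := c^-1.
  have z0 : z != 0 by rewrite invr_eq0.
  have y0 : y != 0 by rewrite mulf_neq0.
  have xE : x = y / z by rewrite /y /z invrK divfK.
  have alE : a l = gen2 y z.
    have : gen2 x 1 = [set c * u | u in gen2 y z].
      by rewrite -gen2_scale /y /z mulrCA divff // mulr1.
    rewrite cE => /seteqP[sub1 sub2]; apply/seteqP; split=> u.
      by move=> au; have [|w gw /(mulfI c0) <-] := sub1 (c * u); first by exists u.
    by move=> gu; have [|w aw /(mulfI c0) <-] := sub2 (c * u); first by exists u.
  have nza : nonzero_ideal (a l) := a_ideal l.
  have [[suba aO] _] := nza.
  have ay : a l y by rewrite alE; apply: gen2l.
  have az : a l z by rewrite alE; apply: gen2r.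
  have [Oy Oz] := (aO _ ay, aO _ az).
  have [hgl hglu] := hg l.
  (* Applied to (y, z) and to (z, y): as x and 1 / x have the same height, both generators are
     bounded. *)
  have bounded u v : integers u -> integers v -> u != 0 -> v != 0 -> a l v ->
      gen2 u v = a l -> height R (u / v) <= B -> bounded_principal B a l (principal v).
    move=> Ou Ov u0 v0 av guv huv; split.
    - by exists v.
    - by exists v => //; apply: principal_id.
    - exact/principal_sub.
    apply: le_trans (idealN_principal_le_height R ha Ou Ov u0 v0) _.
    by rewrite guv ler_wpM2r.
  have [j [jE _]] : exists! j, principal (@g l j) = principal z.
    by apply: hglu; apply: (bounded y z) => //; rewrite -?xE.
  have [i [iE _]] : exists! i, principal (@g l i) = principal y.
    apply: hglu; apply: (bounded z y) => //; first by rewrite gen2C.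
    by rewrite -invf_div -xE (heightV R ha).
  have [gi0 gj0] := (bounded_generator_neq0 hg i, bounded_generator_neq0 hg j).
  have [u Uu yE] := principal_eq_unit y0 (esym iE).
  have [v Uv zE] := principal_eq_unit z0 (esym jE).
  have [u0 v0] := (unit_group_neq0 Uu, unit_group_neq0 Uv).
  pose q := g l i / g l j.
  have q0 : q != 0 by rewrite mulf_neq0 ?invr_eq0.
  have xq : x = u / v * q by rewrite xE yE zE /q; field; rewrite gj0 v0.
  have Uuv : unit_group (u / v) by apply: unit_groupM => //; apply: unit_groupV.
  have [_ /(_ _ Uuv)[[w k] [/= [mu_w uvE] _]]] := heps.
  set e := unit_monomial eps k in uvE.
  have w0 : w != 0 := unit_group_neq0 (roots_of_unity_unit mu_w).
  have e0 : e != 0 := unit_group_neq0 (unit_group_monomial k heps).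
  have gij : gen2 (g l i) (g l j) = a l by rewrite (gen2_principal iE jE).
  have he : height R e <= B * height R q.
    have -> : e = w^-1 * (x * q^-1) by rewrite xq uvE; field; rewrite q0 w0.
    apply: le_trans (heightM_le R ha _ _) _; rewrite ?mulf_neq0 ?invr_eq0 //.
    rewrite (height_root_of_unity R ha) ?mul1r; last exact: roots_of_unityV.
    apply: le_trans (heightM_le R ha _ _) _; rewrite ?invr_eq0 //.
    by rewrite (heightV R ha) // ler_wpM2r // (height_ge0 R ha).
  case: (ltngtP i j) => [ij|ji|/val_inj ij].
  + right; exists (Packet i j k); first by split.
    by left; exists w => //; rewrite xq uvE mulrA.
  + right; exists (Packet j i [ffun t => - k t]).
      split=> //=; first by rewrite gen2C.
      move=> _; rewrite unit_monomialN (heightV R ha) //.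
      by rewrite /packet_quot /= -invf_div (heightV R ha).
    right; exists w => //; rewrite /packet_elt /packet_quot /= unit_monomialN.
    by rewrite -/e xq uvE /q; field; rewrite gi0 gj0 e0.
  + by left; rewrite xq /q ij divff ?mulr1.
(* The two generator quotients differ by a unit, which fixes the indices; the exponents follow from
   uniqueness in [fundamental_units]. *)
have core P P' z : is_packet B a eps g P -> is_packet B a eps g P' ->
    roots_of_unity z -> packet_elt eps g P' = z * packet_elt eps g P -> P = P'.
  case: P P' => [l i j k] [l' i' j' k'] [/= _ gl _] [/= _ gl' _] mu_z E.
  have Ue := unit_group_monomial k heps; have Ue' := unit_group_monomial k' heps.
  have [e0 e'0] := (unit_group_neq0 Ue, unit_group_neq0 Ue').
  rewrite /packet_elt /packet_quot /= in E.
  have qE : g l' i' / g l' j' = (unit_monomial eps k')^-1 *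
      (z * unit_monomial eps k) * (g l i / g l j).
    by rewrite -[LHS](mulKf e'0) E !mulrA.
  have Uv : unit_group ((unit_monomial eps k')^-1 * (z * unit_monomial eps k)).
    by do 2?apply: unit_groupM => //; [apply: unit_groupV|apply: roots_of_unity_unit].
  have Qrec := packet_index_unique ha hg Uv gl gl' qE.
  have kk' : k = k'.
    have q0 : g l i / g l j != 0.
      by rewrite mulf_neq0 ?invr_eq0 // (bounded_generator_neq0 hg).
    (* Once the quotients are known to be equal they cancel, and the second monomial is [z] times
       the first. *)
    have qq' := Qrec (fun l' i' j' => g l' i' / g l' j' = g l i / g l j) (erefl _).
    rewrite qq' [RHS]mulrA in E; move/(mulIf q0): E => E.
    have [_ /(_ _ Ue')[[w m] [_ mu]]] := heps.
    have e1 : (w, m) = (1, k').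
      by apply: mu; split; [apply: roots_of_unity1|rewrite mul1r].
    have e2 : (w, m) = (z, k) by apply: mu.
    by have := e2; rewrite e1 => -[_ ->].
  rewrite -kk'.
  exact: (Qrec (fun l' i' j' => Packet i j k = Packet i' j' k) (erefl _)).
(* The inverse of [packet_elt] has the quotient g_j / g_i, so the indices of [P'] would be those of
   [P] exchanged, against i < j and i' < j'. *)
have swap P P' z : is_packet B a eps g P -> is_packet B a eps g P' ->
    roots_of_unity z -> packet_elt eps g P' <> z / packet_elt eps g P.
  case: P P' => [l i j k] [l' i' j' k'] [/= ij gl _] [/= ij' gl' _] mu_z E.
  have Ue := unit_group_monomial k heps; have Ue' := unit_group_monomial k' heps.
  have [e0 e'0] := (unit_group_neq0 Ue, unit_group_neq0 Ue').
  rewrite /packet_elt /packet_quot /= in E.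
  have qE : g l' i' / g l' j' = (unit_monomial eps k')^-1 *
      (z * (unit_monomial eps k)^-1) * (g l j / g l i).
    by rewrite -[LHS](mulKf e'0) E invfM invf_div !mulrA.
  have Uv : unit_group ((unit_monomial eps k')^-1 * (z * (unit_monomial eps k)^-1)).
    by do 2?apply: unit_groupM; do ?[apply: unit_groupV => //]; apply: roots_of_unity_unit.
  rewrite gen2C in gl.
  have := packet_index_unique ha hg Uv gl gl' qE (Q := fun l i j => (j < i)%N) ij.
  by rewrite ltnNge (ltnW ij').
move=> P P' hP hP' PP'; apply/seteqP; split=> // x [xP xP']; apply: PP'.
have elt0 Q : is_packet B a eps g Q -> packet_elt eps g Q != 0.
  move=> _; rewrite !mulf_neq0 ?invr_eq0 ?(bounded_generator_neq0 hg) //.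
  exact/unit_group_neq0/unit_group_monomial.
have [p0 p'0] := (elt0 _ hP, elt0 _ hP').
have muV := @roots_of_unityV K; have muM := @roots_of_unityM K.
(* If the common element lies in corresponding halves of the two sets, [core] applies; if it lies in
   opposite halves, [swap] does. *)
case: xP => -[z mu_z <-] in xP' *; case: xP' => -[z' mu_z' E].
- have z'0 := unit_group_neq0 (roots_of_unity_unit mu_z').
  apply: (core _ _ (z'^-1 * z)) => //; first by apply: muM => //; apply: muV.
  by rewrite -mulrA -E mulKf.
- have z'0 := unit_group_neq0 (roots_of_unity_unit mu_z').
  have z0 := unit_group_neq0 (roots_of_unity_unit mu_z).
  case: (swap P P' (z' / z)) => //; first by apply: muM => //; apply: muV.
  move: (packet_elt _ _ P) (packet_elt _ _ P') E p0 p'0 => p p' E p0 p'0.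
  apply: (mulIf p0); rewrite divfK //; apply: (mulIf z0); rewrite divfK //.
  by rewrite -mulrA [p * z]mulrC -E mulrC divfK.
- have z'0 := unit_group_neq0 (roots_of_unity_unit mu_z').
  case: (swap P P' (z / z')) => //; first by apply: muM => //; apply: muV.
  apply: (mulfI z'0); rewrite E; move: (packet_elt _ _ P) p0 => p p0.
  by field; rewrite p0 z'0.
- have z'0 := unit_group_neq0 (roots_of_unity_unit mu_z').
  have z0 := unit_group_neq0 (roots_of_unity_unit mu_z).
  apply: (core _ _ (z' / z)) => //; first by apply: muM => //; apply: muV.
  move: (packet_elt _ _ P) (packet_elt _ _ P') E p0 p'0 => p p' E p0 p'0.
  apply: (mulIf (z0)); apply: invr_inj; apply: (mulfI (mulf_neq0 z0 z'0)).
  have -> : z * z' * (p' * z)^-1 = z' / p' by field; rewrite z0 p'0.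
  by rewrite E; field; rewrite z0 z'0 p0.
Qed.
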